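(* Let $X$ be a Banach space and let $F\in C^\infty(X;\mathbb R^m)$, $m\in\mathbb N$, be a smooth mapping. Suppose $0\in X$ is a critical point of $F$ and that, for some $n\ge 2$, the intrinsic differential $\mathcal D_0^nF:\mathrm{dom}(\mathcal D_0^nF)\to\mathrm{coker}(d_0F)$ is regular. Then $F$ is open at $0$, i.e. $F$ maps every neighbourhood of $0$ onto a neighbourhood of $F(0)$.
   Context: Intrinsic differentials. For $v_1,\dots,v_k\in X$ set $D_0^kF(v_1,\dots,v_k)=\frac{d^k}{dt^k}F\big(\sum_{h=1}^k\frac{t^hv_h}{h!}\big)\big|_{t=0}$. Let $\mathrm{coker}(d_0F)=\mathbb R^m/\mathrm{im}(d_0F)$ with quotient map $\mathrm{pr}:\mathbb R^m\to\mathrm{coker}(d_0F)$, and fix a linear complement $\mathrm{coim}(d_0F)\subset X$ of $\ker(d_0F)$. Let $\mathrm{dom}(\mathcal D_0^2F)=\ker(d_0F)\subset X$ and, for $n>2$, $\mathrm{dom}(\mathcal D_0^nF)=\{v\in\mathrm{dom}(\mathcal D_0^{n-1}F)\times\mathrm{coim}(d_0F): D_0^{n-1}F(v)=0\}\subset X^{n-1}$. The intrinsic $n$th differential is $\mathcal D_0^nF(v)=\mathrm{pr}(D_0^nF(v,* ))$, $v\in\mathrm{dom}(\mathcal D_0^nF)$; it does not depend on the last entry $*\in X$. The point $0$ is critical of corank $\ell\in\{1,\dots,m\}$ if $\dim\mathrm{coker}(d_0F)=\ell$. Separately $\delta$-homogeneous maps. A continuous map $w=(w_1,\dots,w_{n-1}):\mathbb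 R^\ell\to X^{n-1}$ is separately $\delta$-homogeneous if there are vectors $v_j^{\beta,\alpha}\in X$, for $j\in\{1,\dots,n-1\}$, $\beta\in\{0,1,2,\dots\}^\ell$ with $|\beta|=j$, and $\alpha\in\{-1,1\}^\ell$, such that for all $t\in\mathbb R^\ell$ and $j=1,\dots,n-1$, $w_j(t)=\sum_{|\beta|=j}t^\beta v_j^{\beta,\mathrm{sgn}(t)}$, where $\mathrm{sgn}(t)=(\mathrm{sgn}(t_1),\dots,\mathrm{sgn}(t_\ell))$ (the choice of $\mathrm{sgn}(0)=\pm1$ is immaterial by continuity of $w$). Regularity. Let $0$ be a critical point of corank $\ell$. $\mathcal D_0^nF$ is regular if there is a separately $\delta$-homogeneous map $w:\mathbb R^\ell\to\mathrm{dom}(\mathcal D_0^nF)$ such that $f:\mathbb R^\ell\to\mathrm{coker}(d_0F)$, $f(t)=\mathcal D_0^nF(w(\varrho(t)))$, with $\varrho(t)=(\mathrm{sgn}(t_1)|t_1|^{1/n},\dots,\mathrm{sgn}(t_\ell)|t_\ell|^{1/n})$, is a homeomorphism with bounded inverse at zero: there is $0<L<\infty$ with $|f^{-1}(\tau)|\le L|\tau|$ for all $\tau\in\mathrm{coker}(d_0F)$. *)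

(* Defs.v *)
From HB Require Import structures.
From mathcomp Require Import all_boot all_order all_algebra generic_quotient.
From mathcomp Require Import ring_quotient.
From mathcomp Require Import all_classical all_reals all_analysis.

Set Implicit Arguments.
Unset Strict Implicit.
Unset Printing Implicit Defensive.

Import Order.TTheory GRing.Theory Num.Theory numFieldNormedType.Exports.

Local Open Scope classical_set_scope.
Local Open Scope ring_scope.
Local Open Scope quotient_scope.

Section Smooth.
Variables (R : realType) (X Y : normedModType R).

(* [D x [:: v1; ...; vk]] is the k-th Frechet derivative of [F] at [x], seen as
   a bounded k-linear map and applied to (v1, ..., vk), under the isometric
   identification of L(X, L^k(X; Y)) with L^(k+1)(X; Y); the last clause is
   Frechet differentiability of x |-> D^k F(x) for the operator norm. *)
Definition smooth (F : X -> Y) : Prop :=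
  exists D : X -> seq X -> Y,
    [/\ forall x, D x [::] = F x,
        forall x s1 s2, linear (fun u => D x (s1 ++ u :: s2)),
        forall x k, exists C : R, forall v, size v = k ->
          `|D x v| <= C * \prod_(u <- v) `|u|
      & forall x k (e : R), 0 < e -> \forall h \near (0 : X),
          forall v, size v = k ->
          `|D (x + h) v - D x v - D x (h :: v)|
            <= e * `|h| * \prod_(u <- v) `|u|].

End Smooth.

Section Cokernel.
Variables (R : realType) (X : lmodType R) (Y : normedModType R).
Variable L : {linear X -> Y}.

Definition im_pred : {pred Y} := fun y => `[< exists x, L x = y >].

Lemma im_pred_submod : submod_closed im_pred.
Proof.
split=> [|a _ _ /asboolP[x <-] /asboolP[y <-]]; apply/asboolP.
  by exists 0; rewrite linear0.
by exists (a *: x + y); rewrite linearP.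
Qed.

HB.instance Definition _ := GRing.isSubmodClosed.Build R Y im_pred
  im_pred_submod.

(* Y / im L, with the quotient topology *)
Definition coker := quotient_topology (Quotient.quot im_pred).

HB.instance Definition _ := Topological.on coker.
HB.instance Definition _ := Quotient.on coker.
HB.instance Definition _ := GRing.isZmodule.Build coker
  (@Quotient.addqA _ im_pred) (@Quotient.addqC _ im_pred)
  (@Quotient.add0q _ im_pred) (@Quotient.addNq _ im_pred).

Definition coker_scale (a : R) (q : coker) : coker := \pi_coker (a *: repr q).

Lemma coker_pi_eq (x y : Y) :
  (\pi_coker x = \pi_coker y) <-> (x - y \in im_pred).
Proof.
by rewrite Quotient.idealrBE; split=> [h|/eqP//]; apply/eqP.
Qed.

Lemma coker_piK (q : coker) : exists x : Y, q = \pi_coker x.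
Proof. by exists (repr q); rewrite reprK. Qed.

Lemma coker_piD (x y : Y) :
  \pi_coker (x + y) = \pi_coker x + \pi_coker y.
Proof. exact: (raddfD (\pi_(Quotient.quot im_pred))). Qed.

Lemma coker_piZ a (x : Y) : coker_scale a (\pi_coker x) = \pi_coker (a *: x).
Proof.
apply/coker_pi_eq; rewrite -scalerBr rpredZ//.
by apply/coker_pi_eq; rewrite reprK.
Qed.

Fact coker_scaleA a b q :
  coker_scale a (coker_scale b q) = coker_scale (a * b) q.
Proof. by have [x ->] := coker_piK q; rewrite !coker_piZ scalerA. Qed.

Fact coker_scale1 : left_id 1 coker_scale.
Proof. by move=> q; have [x ->] := coker_piK q; rewrite coker_piZ scale1r. Qed.

Fact coker_scaleDr : right_distributive coker_scale +%R.
Proof.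
move=> a p q; have [x ->] := coker_piK p; have [y ->] := coker_piK q.
by rewrite -coker_piD !coker_piZ scalerDr coker_piD.
Qed.

Fact coker_scaleDl q : {morph coker_scale^~ q : a b / a + b}.
Proof.
move=> a b; have [x ->] := coker_piK q.
by rewrite !coker_piZ scalerDl coker_piD.
Qed.

HB.instance Definition _ := GRing.Zmodule_isLmodule.Build R coker
  coker_scaleA coker_scale1 coker_scaleDr coker_scaleDl.

Definition coker_norm (q : coker) : R :=
  inf [set `|y| | y in [set y : Y | \pi_coker y = q]].

(* [Vector.axiom l V] is the type of linear bijections V -> 'rV_l. *)
Definition coker_dim (l : nat) : Prop := inhabited (Vector.axiom l coker).

End Cokernel.

Definition complement (R : realType) (X : lmodType R) (K C : set X) : Prop :=
  [/\ submod_closed (mem C), K `&` C = [set 0]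
    & forall x, exists k c, [/\ K k, C c & x = k + c]].

Definition homeomorphism_with (S T : topologicalType) (f : S -> T) (g : T -> S)
    : Prop :=
  [/\ continuous f, continuous g, cancel f g & cancel g f].

Section SeparatelyHomogeneous.
Variables (R : realType) (X : normedModType R) (l : nat).

(* sgn(0) = 1 by convention *)
Definition sgnv (t : 'rV[R]_l) : 'rV[R]_l :=
  \row_i (if 0 <= t ord0 i then 1 else -1).

Definition rootv (n : nat) (t : 'rV[R]_l) : 'rV[R]_l :=
  \row_i (Num.sg (t ord0 i) * `|t ord0 i| `^ n%:R^-1).

(* The entry of index j of [w t] is w_(j+1)(t).  The multi-indices b of weight
   k = |b| are the finite functions 'I_l -> {0, ..., k} of sum k. *)
Definition separately_homogeneous (n : nat) (w : 'rV[R]_l -> 'rV[X]_n) : Prop :=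
  continuous w /\
  exists v : forall k : nat, {ffun 'I_l -> 'I_k.+1} -> 'rV[R]_l -> X,
    forall (t : 'rV[R]_l) (j : 'I_n),
      w t ord0 j =
      \sum_(b : {ffun 'I_l -> 'I_j.+2} | (\sum_i b i)%N == j.+1)
         (\prod_i t ord0 i ^+ b i) *: v j.+1 b (sgnv t).

End SeparatelyHomogeneous.

Section IntrinsicDifferential.
Variables (R : realType) (X : normedModType R) (m : nat).
Variable F : X -> 'rV[R]_m.

Definition curve_diff (k : nat) (v : 'rV[X]_k) : 'rV[R]_m :=
  derive1n k
    (fun t : R => F (\sum_(h < k) (t ^+ h.+1 / (h.+1)`!%:R) *: v ord0 h)) 0.

Definition ker_diff : set X := [set x | 'd F (0 : X) x = 0].

Local Notation coker_diff := (coker ('d F (0 : X))).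

Definition critical_of_corank (l : nat) : Prop :=
  (1 <= l <= m)%N /\ coker_dim ('d F (0 : X)) l.

Definition row_init (k : nat) (v : 'rV[X]_k.+1) : 'rV[X]_k :=
  \row_i v ord0 (widen_ord (leqnSn k) i).

Definition row_snoc (k : nat) (v : 'rV[X]_k) (x : X) : 'rV[X]_k.+1 :=
  \row_i oapp (v ord0) x (unlift ord_max i).

Variable coim : set X.

(* The index is shifted by 2: [intrinsic_dom n] is dom(D_0^(n+2) F), a subset
   of X^(n+1). *)
Fixpoint intrinsic_dom (n : nat) : set 'rV[X]_n.+1 :=
  if n is p.+1 then
    [set v | [/\ intrinsic_dom (row_init v), coim (v ord0 ord_max)
               & curve_diff v = 0]]
  else [set v | ker_diff (v ord0 ord0)].

(* D_0^(n+2) F; the last argument of [curve_diff] is irrelevant modulo the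
   image of d_0 F, and is set to 0. *)
Definition intrinsic_diff (n : nat) (v : 'rV[X]_n.+1) : coker_diff :=
  \pi_coker_diff (curve_diff (row_snoc v 0)).

(* Regularity of D_0^n F, for n >= 2 *)
Definition regular_intrinsic_diff (n l : nat) : Prop :=
  exists w : 'rV[R]_l -> 'rV[X]_n.-2.+1,
    [/\ separately_homogeneous w,
        forall t, intrinsic_dom (w t)
      & exists g : coker_diff -> 'rV[R]_l,
          homeomorphism_with (fun t => intrinsic_diff (w (rootv n t))) g /\
          exists2 L : R, 0 < L & forall q, `|g q| <= L * coker_norm q].

End IntrinsicDifferential.

(* Main.v *)
From HB Require Import structures.
Require Import Defs.
From mathcomp Require Import all_boot all_order all_fingroup all_algebra.
From mathcomp Require Import generic_quotient.
From mathcomp Require Import all_classical all_reals all_analysis.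
From mathcomp Require Import ring lra zify.
Import Order.TTheory GRing.Theory Num.Theory numFieldNormedType.Exports.
Set Implicit Arguments. Unset Strict Implicit. Unset Printing Implicit Defensive.
Local Open Scope classical_set_scope.
Local Open Scope ring_scope.

(** Fix p in R^m.  The inverse of the homeomorphism provided by regularity
    turns the class of p in the cokernel into a jet (w_1, ..., w_(n-1)) along
    which the derivatives of order 1, ..., n-1 of t |-> F(sum_h t^h w_h / h!)
    vanish at 0, while the n-th one equals p modulo the image of d_0F.  The
    n-th derivative involves w_n only through the summand d_0F(w_n)
    ([taylor_coef_top]), so a continuous section of d_0F over its image
    ([linear_section]) gives a vector w_n that makes the n-th derivative equal
    to p.  The jet depends continuously on p, and Taylor's formula gives
      F(sum_h t^h w_h / h!) = F(0) + (t^n / n!) p + O(t^(n+1))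
    uniformly for |p| <= 2 ([uniform_taylor]).  Hence, for small t > 0, the
    rescaled map p |-> (n! / t^n) (F(sum_h t^h w_h / h!) - F(0)) is continuous
    and at distance at most 1 from the identity on the ball of radius 2.  Such
    a map covers the unit ball ([near_identity_onto]), so F maps a set of
    points as close to 0 as desired onto a ball around F(0).

    Two tools carry the argument.

    The first is the higher chain rule along a curve with derivatives
    c_0, c_1, ...: the k-th derivative of F o c_0 is a sum of terms
    D^r F(c_0)(c_(i_1), ..., c_(i_r)) whose index lists are generated by a
    simple recursion on k ([faa_di_bruno]).  At 0 it expresses the
    differentials D_0^k F through the derivatives of F; along the curve it
    bounds the remainder, because those derivatives are bounded near 0.

    The second is the theorem of Poincare and Miranda, the form of Brouwer's
    theorem used to invert the perturbed identity.  It follows from Kuhn's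
    combinatorial lemma on labelled grids, which is obtained here from a
    discrete degree: the sum, over all simplices of the Kuhn triangulation, of
    the determinants that measure the signed volumes of their images under the
    labels.  A discrete Stokes
    formula shows that this number depends only on the boundary labels
    ([degree_change_row]), and for the simplest labels it is n!; as it is
    nonzero, some simplex has an image of nonzero volume. *)

(** * Kuhn's lemma through a discrete degree *)

Lemma det_prop_rows (A : comPzRingType) (n : nat) (M : 'M[A]_n) (i j : 'I_n) (c : A) :
  i != j -> (forall k, M i k = c * M j k) -> \det M = 0.
Proof.
move=> neq_ij eqM.
pose B := \matrix_(a, b) (if a == i then M j b else M a b).
have eq1 : row i M = c *: row i B + 0 *: row i B.
  by apply/rowP=> k; rewrite !mxE eqxx eqM mul0r addr0.
have eq2 : row' i B = row' i M.
  by apply/matrixP=> a b; rewrite !mxE eq_sym (negPf (neq_lift _ _)).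
rewrite (determinant_multilinear eq1 eq2 eq2) mul0r addr0.
rewrite (determinant_alternate neq_ij) ?mulr0// => k.
by rewrite !mxE eqxx eq_sym (negPf neq_ij).
Qed.

Section Degree.
Variables (n p : nat).
Local Notation point := ('I_n -> nat).
Local Notation box := {ffun 'I_n -> 'I_p.+1}.

(** The permutation [s] records at what time each coordinate is increased: the
    vertices at times 0, ..., n form a simplex of the Kuhn triangulation of the
    unit cube with lowest corner [b]. *)
Definition kuhn_vertex (b : point) (s : 'S_n) (t : nat) : point :=
  fun i => (b i + (s i < t))%N.

(** The row of index 0 is meant to be constant equal to 1: the determinant is
    then n! times the signed volume of the image of the simplex under the
    remaining n labels. *)
Definition label_mx (L : 'I_n.+1 -> point -> int) (b : point) (s : 'S_n) :=
  \matrix_(k < n.+1, t < n.+1) L k (kuhn_vertex b s t).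

Definition degree (L : 'I_n.+1 -> point -> int) : int :=
  \sum_(b : box) \sum_(s : 'S_n)
     (-1) ^+ s * \det (label_mx L (fun i => b i : nat) s).

Definition admissible (L : 'I_n.+1 -> point -> int) : Prop :=
  [/\ forall x, L ord0 x = 1,
      forall i (x : point), x i = 0%N -> L (lift ord0 i) x = 0
    & forall i (x : point), x i = p.+1 -> L (lift ord0 i) x = 1].

End Degree.

Definition on_face (n p : nat) (d : 'I_n) (u : 'I_n -> 'I_n -> nat) : Prop :=
  (forall t, u t d = 0%N) \/ (forall t, u t d = p.+1).

Section Facets.
Variables (n p : nat) (Phi : ('I_n.+1 -> 'I_n.+1 -> nat) -> int).
Local Notation N := n.+1.
Hypothesis Phi0 : forall d u, on_face p d u -> Phi u = 0.

Definition facet (b : 'I_N -> nat) (s : 'S_N) (j : 'I_N.+1) : 'I_N -> 'I_N -> nat :=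
  fun t => kuhn_vertex b s (lift j t).

(** A facet that omits an intermediate vertex is shared with the simplex of the
    same cube in which the two steps around that vertex are exchanged. *)
Lemma inner_facet_sum b (j : 'I_N.+1) : (0 < j < N)%N ->
  \sum_(s : 'S_N) (-1) ^+ s * Phi (facet b s j) = 0.
Proof.
move=> /andP[j0 jN].
have h1 : (j.-1 < N)%N by apply: leq_ltn_trans jN; rewrite leq_pred.
pose c := tperm (Ordinal h1) (Ordinal jN).
have odd_c : c = true :> bool.
  by rewrite odd_tperm -val_eqE /=; lia.
have : \sum_(s : 'S_N) (-1) ^+ s * Phi (facet b s j) =
       - \sum_(s : 'S_N) (-1) ^+ s * Phi (facet b s j).
  rewrite {1}(reindex_inj (mulIg c)) -sumrN; apply: eq_bigr => s _.
  rewrite odd_permM odd_c signr_addb expr1 mulrN1 mulNr.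
  congr (- (_ * Phi _)); apply/funext => t; apply/funext => i.
  rewrite /facet /kuhn_vertex permM; congr (_ + nat_of_bool _)%N.
  have neq : lift j t != j :> nat by rewrite eq_sym; apply: neq_lift.
  case: tpermP => [->|->|//] /=; move: neq => /=; lia.
by set a := (X in X = - X); lia.
Qed.

(** Translation by one step in the direction [d], made a bijection of the grid
    by wrapping around; the boxes that wrap have their facet on a face of the
    grid. *)
Definition shift_box (d : 'I_N) (b : {ffun 'I_N -> 'I_p.+1}) : {ffun 'I_N -> 'I_p.+1} :=
  [ffun i => if i == d then ordS (b i) else b i].

Lemma shift_box_inj d : injective (shift_box d).
Proof.
move=> b b' /ffunP eqb; apply/ffunP => i; have := eqb i; rewrite !ffunE.
by case: eqP => // _ /(bij_inj (ordS_bij _)).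
Qed.

(** The facet omitting the first vertex is also the facet omitting the last
    vertex of a simplex in the next cube: the one in the direction [d] of the
    first step, with the first step moved to the end.  This cyclic permutation
    of n+1 steps has sign (-1)^n. *)
Lemma outer_facet_sum :
  \sum_(b : {ffun 'I_N -> 'I_p.+1}) \sum_(s : 'S_N)
     (-1) ^+ s * Phi (facet (fun i => b i : nat) s ord0) =
  (-1) ^+ n * \sum_(b : {ffun 'I_N -> 'I_p.+1}) \sum_(s : 'S_N)
     (-1) ^+ s * Phi (facet (fun i => b i : nat) s ord_max).
Proof.
pose c : 'S_N := lift_perm ord0 ord_max 1%g.
have odd_c : c = odd n :> bool by rewrite odd_lift_perm odd_perm1 /= addbF.
rewrite exchange_big [in RHS]exchange_big /=.
rewrite [in RHS](reindex_inj (mulIg c)) mulr_sumr; apply: eq_bigr => s _ /=.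
pose d := (s^-1)%g ord0.
rewrite [in RHS](reindex_inj (@shift_box_inj d)) mulr_sumr; apply: eq_bigr => b _ /=.
rewrite odd_permM odd_c signr_addb -[(-1) ^+ n]signr_odd.
rewrite mulrA [_ * (-1) ^+ odd n]mulrC mulrA -signr_addb addbb mul1r; congr (_ * _).
have sd : s d = ord0 by rewrite /d permKV.
have cs i : c (s i) = (if i == d then n else (s i).-1) :> nat.
  case: eqP => [->|/eqP neq]; first by rewrite sd lift_perm_id.
  have : s i != ord0 by rewrite -sd (inj_eq perm_inj).
  case: (unliftP ord0 (s i)) => [k ->|->]; last by rewrite eqxx.
  by rewrite lift_perm_lift perm1 lift_max lift0.
have scd i t : ((s * c)%g i < (lift ord_max t : 'I_N.+1))%N =
               ((i != d) && (s i < (lift ord0 t : 'I_N.+1)))%N.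
  rewrite permM lift_max lift0 cs; case: eqP => [->|/eqP neq] /=.
    by apply/negbTE; rewrite -leqNgt -ltnS; apply: ltn_ord.
  have : s i != ord0 by rewrite -sd (inj_eq perm_inj).
  by rewrite -val_eqE /=; lia.
have [bd|bd] := eqVneq (b d : nat) p.
  rewrite (@Phi0 d) 1?(@Phi0 d)//.
  - left=> t; rewrite /facet /kuhn_vertex scd eqxx addn0 ffunE eqxx /= bd.
    by rewrite modnn.
  - by right=> t; rewrite /facet /kuhn_vertex sd lift0 bd ltn0Sn addn1.
congr Phi; apply/funext => t; apply/funext => i.
rewrite /facet /kuhn_vertex scd ffunE; case: eqP => [->|//].
rewrite sd lift0 /= addn0 addn1 modn_small//.
by have := ltn_ord (b d); lia.
Qed.

(** Discrete Stokes formula: a function of facets that vanishes on the boundary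
    of the grid has zero signed sum over the facets of all simplices, since
    every interior facet is shared by two simplices inducing opposite
    orientations. *)
Lemma facet_sum0 :
  \sum_(b : {ffun 'I_N -> 'I_p.+1}) \sum_(s : 'S_N) \sum_(j < N.+1)
     (-1) ^+ j * ((-1) ^+ s * Phi (facet (fun i => b i : nat) s j)) = 0.
Proof.
rewrite (eq_bigr (fun b : {ffun 'I_N -> 'I_p.+1} =>
  \sum_(s : 'S_N) (-1) ^+ s * Phi (facet (fun i => b i : nat) s ord0) +
  (-1) ^+ N * \sum_(s : 'S_N) (-1) ^+ s * Phi (facet (fun i => b i : nat) s ord_max))).
  rewrite big_split /= outer_facet_sum -mulr_sumr exprS mulN1r mulNr.
  by rewrite subrr.
move=> b _; rewrite exchange_big /= big_ord_recl big_ord_recr /=.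
rewrite -!mulr_sumr mul1r; congr (_ + _).
rewrite [X in X + _]big1 ?add0r => [|j _].
  congr (_ * _); apply: eq_bigr => s _; congr (_ * Phi (facet _ _ _)).
rewrite -mulr_sumr inner_facet_sum ?mulr0//.
by rewrite lift0 /= ltnS ltn_ord.
Qed.
End Facets.

(** Expanding along the row [i] where [L] and [L'] differ, the difference of the
    two volumes is a combination of facet minors, weighted by the values of
    [lam = L i - L' i] at the opposite vertices.  As the minors have zero sum,
    the weight can be replaced by minus the sum of [lam] over the facet itself,
    so that [facet_sum0] applies: on a face orthogonal to the direction of row
    [i] the weights vanish, and on the other faces a row of the minor is
    proportional to the row of ones. *)
Lemma degree_change_row (n p : nat) (L L' : 'I_n.+2 -> ('I_n.+1 -> nat) -> int)
    (r : 'I_n.+1) :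
  admissible p L -> admissible p L' ->
  (forall k, k != lift ord0 r -> L k = L' k) ->
  degree p L = degree p L'.
Proof.
move=> [L1 L2 L3] [L'1 L'2 L'3] eqL.
set i := lift ord0 r.
pose lam x := L i x - L' i x.
pose Phi (u : 'I_n.+1 -> 'I_n.+1 -> nat) : int :=
  (\sum_t lam (u t)) * \det (\matrix_(k, t) L (lift i k) (u t)).
have Phi0 d u : on_face p d u -> Phi u = 0.
  move=> fu; rewrite /Phi; have [dr|dr] := eqVneq d r.
    rewrite big1 ?mul0r// => t _; rewrite /lam /i -dr.
    case: fu => /(_ t) fu; first by rewrite L2 // L'2 // subrr.
    by rewrite L3 // L'3 // subrr.
  have [k0 k0E] : exists k0, ord0 = lift i k0.
    case: (unliftP i ord0) => [k k0|/eqP]; first by exists k.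
    by rewrite (negPf (neq_lift _ _)).
  have [k1 k1E] : exists k1, lift ord0 d = lift i k1.
    case: (unliftP i (lift ord0 d)) => [k kE|/lift_inj/eqP]; first by exists k.
    by rewrite (negPf dr).
  have neqk : k1 != k0.
    by apply/eqP=> eqk; have := neq_lift ord0 d; rewrite {1}k0E k1E eqk eqxx.
  have [c cE] : exists c, forall t, L (lift i k1) (u t) = c.
    case: fu => fu; first by exists 0 => t; rewrite -k1E; apply: L2.
    by exists 1 => t; rewrite -k1E; apply: L3.
  rewrite (@det_prop_rows _ _ _ k1 k0 c) ?mulr0// => t.
  by rewrite !mxE cE -k0E L1 mulr1.
apply/eqP; rewrite -subr_eq0; apply/eqP; rewrite /degree.
have /(congr1 ( *%R (- (-1) ^+ i))) sum0 := facet_sum0 Phi0.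
rewrite mulr0 in sum0; apply: etrans sum0; rewrite -sumrB mulr_sumr.
apply: eq_bigr => b _; rewrite -sumrB mulr_sumr; apply: eq_bigr => s _.
rewrite -mulrBr !mulr_sumr.
set bb := fun i => _.
have cofL t : cofactor (label_mx L' bb s) i t = cofactor (label_mx L bb s) i t.
  congr (_ * \det _); apply/matrixP => k v; rewrite !mxE eqL//.
  by rewrite eq_sym neq_lift.
(* Expansion of the row of ones along the cofactors of row [i]. *)
have cof0 : \sum_t cofactor (label_mx L bb s) i t = 0.
  have /matrixP/(_ ord0 i) := mul_mx_adj (label_mx L bb s).
  rewrite !mxE (negPf (neq_lift _ _)) mulr0n => detE; apply: etrans detE.
  apply: eq_bigr => t _.
  by rewrite !mxE L1 mul1r.
rewrite (expand_det_row _ i) (expand_det_row (label_mx L' _ _) i) -sumrB.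
under eq_bigr do rewrite cofL !mxE -mulrBl -/(lam _).
pose S := \sum_(t < n.+2) lam (kuhn_vertex bb s t).
have -> : \sum_(t < n.+2) lam (kuhn_vertex bb s t) * cofactor (label_mx L bb s) i t =
  - \sum_(t < n.+2) (S - lam (kuhn_vertex bb s t)) * cofactor (label_mx L bb s) i t.
  under [in RHS]eq_bigr do rewrite mulrBl.
  by rewrite sumrB -mulr_sumr cof0 mulr0 sub0r opprK.
rewrite mulrN mulr_sumr -sumrN; apply: eq_bigr => t _.
have -> : S - lam (kuhn_vertex bb s t) = \sum_t' lam (facet bb s t t').
  by rewrite /S (bigD1_ord t) //= addrAC subrr add0r.
rewrite /cofactor exprD.
have -> : \det (row' i (col' t (label_mx L bb s))) =
          \det (\matrix_(k, t') L (lift i k) (facet bb s t t')).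
  by congr (\det _); apply/matrixP => k v; rewrite !mxE.
rewrite /Phi.
move: ((-1) ^+ s) ((-1) ^+ i) ((-1) ^+ t) (\sum_t' _) (\det _) => a e f g h.
by rewrite mulNr; congr (- _); ring.
Qed.

(** Only the cube at the origin has nonconstant labels in every direction. *)
Definition std_label (n : nat) (k : 'I_n.+1) (x : 'I_n -> nat) : int :=
  if unlift ord0 k is Some i then (0 < x i)%N%:R else 1.

Lemma std_label_admissible (n p : nat) : admissible p (@std_label n).
Proof.
by split=> [x|i x xi|i x xi]; rewrite /std_label ?unlift_none ?liftK // xi.
Qed.

Lemma degree_std (n p : nat) : degree p (@std_label n) = n`!%:R.
Proof.
rewrite /degree (bigD1 [ffun=> ord0])//= [X in _ + X]big1 ?addr0; last first.
  move=> b b0; apply: big1 => s _.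
  have [d bd] : exists d, (0 < b d)%N.
    apply/existsP; apply: contra_neqT b0 => /existsPn b0.
    by apply/ffunP=> d; rewrite ffunE; apply/val_inj/eqP; rewrite /= -leqn0 leqNgt b0.
  rewrite (@det_prop_rows _ _ _ (lift ord0 d) ord0 1) ?mulr0// => t.
  rewrite !mxE /std_label liftK unlift_none /kuhn_vertex mul1r.
  by case: (b d : nat) bd.
pose T : 'M[int]_n.+1 := \matrix_(r, t) (r <= t)%N%:R.
have detT : \det T = 1.
  rewrite -det_tr det_trig.
    by apply: big1 => i _; rewrite !mxE leqnn.
  by apply/is_trig_mxP => i j ij; rewrite !mxE leqNgt ij.
rewrite (eq_bigr (fun=> 1)) ?sumr_const ?card_Sn// => s _.
have -> : label_mx (@std_label n) (fun i => [ffun=> ord0 : 'I_p.+1] i : nat) s =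
          row_perm (lift_perm ord0 ord0 s) T.
  apply/matrixP => k t; rewrite !mxE /std_label.
  case: (unliftP ord0 k) => [i ->|->].
    by rewrite lift_perm_lift lift0 /kuhn_vertex ffunE add0n; case: (s i < t)%N.
  by rewrite lift_perm_id.
by rewrite row_permE det_mulmx detT mulr1 det_perm odd_lift_perm /= -signr_addb addbb.
Qed.

(** The rows of an admissible labelling are replaced one at a time by those of
    [std_label]. *)
Lemma admissible_degree (n p : nat) (L : 'I_n.+2 -> ('I_n.+1 -> nat) -> int) :
  admissible p L -> degree p L = n.+1`!%:R.
Proof.
move=> aL.
pose H (j : nat) (k : 'I_n.+2) := if (k <= j)%N then @std_label n.+1 k else L k.
have aS := std_label_admissible n.+1 p.
have aH j : admissible p (H j).
  case: aL => L1 L2 L3; case: aS => S1 S2 S3.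
  by split=> [x|i x xi|i x xi]; rewrite /H; case: (_ <= j)%N;
    first [exact: S1|exact: L1|exact: S2|exact: L2|exact: S3|exact: L3].
have H0 : H 0%N = L.
  apply/funext => k; apply/funext => x; rewrite /H leqn0.
  case: eqP => // k0; have -> : k = ord0 by apply/val_inj.
  by case: aL => -> _ _; case: aS => -> _ _.
have Hn : H n.+1 = @std_label n.+1.
  by apply/funext => k; rewrite /H -ltnS ltn_ord.
rewrite -(degree_std n.+1 p) -Hn -[in LHS]H0.
suff eqH j : (j <= n.+1)%N -> degree p (H 0%N) = degree p (H j) by exact: eqH.
elim: j => // j IH jn; rewrite IH ?(ltnW jn)//.
apply: (@degree_change_row _ _ _ _ (Ordinal jn)) => // k.
rewrite -val_eqE /= /bump add1n => kj; rewrite /H [(k <= j.+1)%N]leq_eqVlt (negPf kj) /=.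
by rewrite ltnS.
Qed.

(** If every cube had a label that is constant on it, then each matrix would have
    a row proportional to the row of ones, and the degree would vanish. *)
Lemma kuhn (n p : nat) (l : 'I_n -> ('I_n -> nat) -> bool) :
  (forall i (x : 'I_n -> nat), x i = 0%N -> l i x = false) ->
  (forall i (x : 'I_n -> nat), x i = p.+1 -> l i x = true) ->
  exists b : 'I_n -> nat, (forall i, (b i <= p)%N) /\
    forall i, exists x y : 'I_n -> nat,
      [/\ forall j, (b j <= x j <= (b j).+1)%N,
          forall j, (b j <= y j <= (b j).+1)%N, l i x = false & l i y = true].
Proof.
case: n l => [|n] l l0 l1; first by exists (fun=> 0%N); split=> [|[]].
pose L (k : 'I_n.+2) (x : 'I_n.+1 -> nat) : int :=
  if unlift ord0 k is Some i then (l i x)%:R else 1.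
have aL : admissible p L.
  split=> [x|i x xi|i x xi]; rewrite /L ?unlift_none ?liftK //.
    by rewrite l0.
  by rewrite l1.
have degN0 : degree p L != 0 by rewrite (admissible_degree aL) pnatr_eq0 -lt0n fact_gt0.
have [b] : exists b : {ffun 'I_n.+1 -> 'I_p.+1}, exists s : 'S_n.+1,
    \det (label_mx L (fun i => b i : nat) s) != 0.
  apply: contrapT => nob; case/eqP: degN0; rewrite /degree big1// => b _.
  rewrite big1// => s _; apply/eqP; rewrite mulf_eq0; apply/orP; right.
  by apply: contrapT => /negP detN0; apply: nob; exists b, s.
case=> s detN0; exists (fun i => b i : nat); split=> [i|i].
  by rewrite -ltnS.
set bb := fun i => _ in detN0 *.
pose v t := kuhn_vertex bb s t.
have vP t j : (bb j <= v t j <= (bb j).+1)%N.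
  by rewrite /v /kuhn_vertex; case: (_ < _)%N; rewrite /= ?addn0 ?addn1 leqnn ?leqnSn.
suff [[t lt] [t' lt']] : (exists t, l i (v t) = false) /\ (exists t, l i (v t) = true).
  by exists (v t), (v t'); split=> // j; apply: vP.
apply: contrapT => /not_andP h; move/eqP: detN0; apply.
have [c cP] : exists c : bool, forall t, l i (v t) = c.
  case: h => /forallNP h; [exists true|exists false] => t; have := h t;
    by case: (l i (v t)).
apply: (@det_prop_rows _ _ _ (lift ord0 i) ord0 c%:R) => // t.
by rewrite !mxE /L liftK unlift_none mulr1 -/(v t) cP.
Qed.

(** * The theorem of Poincare and Miranda *)

Section RowNorm.
Variables (R : realType) (m : nat).

Lemma row_norm_leP (x : 'rV[R]_m) (c : R) : 0 <= c ->
  (`|x| <= c <-> forall i, `|x ord0 i| <= c).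
Proof.
move=> c0; rewrite /Num.norm /= mx_normrE; split=> [/bigmax_leP[_ h] i|h].
  exact: (h (ord0, i)).
by apply/bigmax_leP; split=> // -[i j] _; rewrite /= [i]ord1; apply: h.
Qed.

End RowNorm.

Lemma closed_ball_compact (R : realType) (n : nat) (r : R) :
  compact [set x : 'rV[R]_n | `|x| <= r].
Proof.
apply: bounded_closed_compact.
  exists r; split; first exact: num_real.
  by move=> s rs x /= xr; apply: le_trans xr (ltW rs).
have -> : [set x : 'rV[R]_n | `|x| <= r] = Num.norm @^-1` [set y | y <= r] by [].
by apply: closed_comp => [x _|]; [exact: norm_continuous|exact: closed_le].
Qed.

Section Miranda.
Variables (R : realType) (n : nat) (r : R) (G : 'rV[R]_n -> 'rV[R]_n).
Hypotheses (r0 : 0 < r) (cG : continuous G).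
Hypothesis G_ge0 : forall (x : 'rV[R]_n) i, `|x| <= r -> x ord0 i = r -> 0 <= G x ord0 i.
Hypothesis G_le0 : forall (x : 'rV[R]_n) i, `|x| <= r -> x ord0 i = - r -> G x ord0 i <= 0.

(** Coordinates are truncated at [p.+1] so that every point lies in the cube. *)
Definition grid_point (p : nat) (x : 'I_n -> nat) : 'rV[R]_n :=
  \row_i (r * (2 * (minn (x i) p.+1)%:R / p.+1%:R - 1)).

Lemma grid_point_cube p x : `|grid_point p x| <= r.
Proof.
apply/row_norm_leP => [|i]; first exact: ltW.
rewrite mxE normrM gtr0_norm// ler_piMr ?(ltW r0)//.
have h : (minn (x i) p.+1)%:R / p.+1%:R <= 1 :> R.
  by rewrite ler_pdivrMr// mul1r ler_nat geq_minr.
have h' : 0 <= (minn (x i) p.+1)%:R / p.+1%:R :> R by rewrite divr_ge0.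
rewrite ler_norml -mulrA; move: (_ / _) h h' => q q1 q0.
by apply/andP; split; lra.
Qed.

Lemma grid_point_dist p x b :
  (forall i, (b i <= x i <= (b i).+1)%N) ->
  `|grid_point p x - grid_point p b| <= 2 * r / p.+1%:R.
Proof.
move=> bx; apply/row_norm_leP => [|i]; first by rewrite divr_ge0// mulr_ge0// ltW.
rewrite !mxE -mulrBr opprB addrA subrK -!mulrA -mulrBr -mulrBl mulrCA.
rewrite normrM ger0_norm// ler_wpM2l//.
rewrite normrM gtr0_norm// ler_wpM2l ?(ltW r0)//.
rewrite normrM normfV [X in _ / X]ger0_norm// ler_piMl ?invr_ge0//.
have /andP[h1 h2] := bx i.
have -> : (minn (x i) p.+1)%:R - (minn (b i) p.+1)%:R =
   (minn (x i) p.+1 - minn (b i) p.+1)%:R :> R by rewrite natrB//; lia.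
by rewrite normr_nat lern1; lia.
Qed.

(** Kuhn's lemma for the labels given by the signs of the components of [G];
    the values forced on the boundary agree with the sign conditions there. *)
Lemma approximate_zero p : exists z : 'rV[R]_n, `|z| <= r /\
  forall i, exists a c : 'rV[R]_n,
    [/\ `|a - z| <= 2 * r / p.+1%:R, `|c - z| <= 2 * r / p.+1%:R,
        G a ord0 i <= 0 & 0 <= G c ord0 i].
Proof.
pose l (i : 'I_n) (x : 'I_n -> nat) : bool :=
  if x i == 0%N then false else
  if (p < x i)%N then true else 0 <= G (grid_point p x) ord0 i.
have [] := @kuhn n p l.
- by move=> i x xi; rewrite /l xi.
- by move=> i x xi; rewrite /l xi /= ltnS leqnn.
move=> b [_ bP]; exists (grid_point p b); split; first exact: grid_point_cube.
move=> i; have [x [y [bx by_ lx ly]]] := bP i.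
exists (grid_point p x), (grid_point p y); split; try exact: grid_point_dist.
- move: lx; rewrite /l; case: eqP => [xi _|_].
    apply: G_le0; first exact: grid_point_cube.
    by rewrite mxE xi min0n mulr0 mul0r sub0r mulrN1.
  by case: ifP => // _ /negbT; rewrite -ltNge => /ltW.
- move: ly; rewrite /l; case: eqP => // _; case: ifP => // yi _.
  apply: G_ge0; first exact: grid_point_cube.
  by rewrite mxE (minn_idPr _)// mulfK ?pnatr_eq0//; ring.
Qed.

(** A limit point of the approximate zeros is a zero. *)
Lemma poincare_miranda : exists2 x : 'rV[R]_n, `|x| <= r & G x = 0.
Proof.
have [z zP] := choice approximate_zero.
pose K : set 'rV[R]_n := [set x | `|x| <= r].
have Kc : compact K := @closed_ball_compact R n r.
have zK : (z @ \oo) K by exists 0%N => // p _; have [] := zP p.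
have [x [Kx xcl]] := Kc (z @ \oo) _ zK.
exists x => //; apply/rowP => i; rewrite [RHS]mxE.
(* Whole small cells lie close to [x], where a strict sign of [G] persists. *)
have key (e : R) : 0 < e -> exists p,
    forall a : 'rV[R]_n, `|a - z p| <= 2 * r / p.+1%:R -> `|x - a| < e.
  move=> e0.
  have e'0 : 0 < e / 2 / (2 * r) by rewrite !divr_gt0// mulr_gt0.
  have [N _ hN] := near_infty_natSinv_lt (PosNum e'0).
  have Ainf : (z @ \oo) [set a | exists2 p, 2 * r / p.+1%:R < e / 2 & a = z p].
    exists N => // p Np; exists p => //.
    by rewrite mulrC -ltr_pdivlMr ?mulr_gt0//; apply: hN.
  have Bx : nbhs x (ball x (e / 2)) by apply: nbhsx_ballx; rewrite divr_gt0.
  have [_ [[p pe ->]]] := xcl _ _ Ainf Bx.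
  rewrite -ball_normE /= => xz; exists p => a az.
  have -> : x - a = (x - z p) - (a - z p) by rewrite opprB addrA subrK.
  apply: le_lt_trans (ler_normB _ _) _.
  rewrite [e]splitr; apply: ltrD => //; exact: le_lt_trans az pe.
have cGi : {for x, continuous (fun y => G y ord0 i)}.
  apply: (@continuous_comp _ _ _ G (fun M : 'rV[R]_n => M ord0 i)); first exact: cG.
  exact: coord_continuous.
apply/eqP; rewrite eq_le; apply/andP; split; rewrite leNgt; apply/negP => Gx.
- have nG : nbhs x [set y | 0 < G y ord0 i] := @cvgr_gt R _ (nbhs x) (nbhs_filter x) _ _ cGi _ Gx.
  have [e /= e0 he] := iffLR (nbhs_ballP _ _) nG.
  have [p hp] := key e e0; have [_ /(_ i)[a [c [az cz Ga Gc]]]] := zP p.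
  have := he a; rewrite -ball_normE /= => /(_ (hp a az)); rewrite ltNge Ga //.
- have nG : nbhs x [set y | G y ord0 i < 0] := @cvgr_lt R _ (nbhs x) (nbhs_filter x) _ _ cGi _ Gx.
  have [e /= e0 he] := iffLR (nbhs_ballP _ _) nG.
  have [p hp] := key e e0; have [_ /(_ i)[a [c [az cz Ga Gc]]]] := zP p.
  have := he c; rewrite -ball_normE /= => /(_ (hp c cz)); rewrite ltNge Gc //.
Qed.

End Miranda.

(** On the faces of the cube of radius 2, the components of Q - y cannot have the
    sign opposite to those of the identity, since |Q - id| <= 1 and |y| <= 1. *)
Lemma near_identity_onto (R : realType) (m : nat) (Q : 'rV[R]_m -> 'rV[R]_m) :
  continuous Q -> (forall p, `|p| <= 2 -> `|Q p - p| <= 1) ->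
  forall y, `|y| <= 1 -> exists2 p, `|p| <= 2 & Q p = y.
Proof.
move=> cQ Qp y y1.
have cG : continuous (fun p => Q p - y).
  by move=> p; exact: (@cvgB _ _ _ (nbhs p) (nbhs_filter p) _ _ _ _ (cQ p) (cvg_cst _)).
have coordQ (p : 'rV[R]_m) i : `|p| <= 2 -> `|Q p ord0 i - p ord0 i| <= 1.
  by move=> /Qp /row_norm_leP -/(_ ler01 i); rewrite !mxE.
have coordy i : `|y ord0 i| <= 1 by move: y1 => /row_norm_leP; apply.
have [|||p p2 Qpy] := @poincare_miranda R m 2 _ _ cG; first by [].
- move=> p i p2 pi; have := coordQ p i p2; have := coordy i.
  by rewrite !mxE pi !ler_norml => /andP[? ?] /andP[? ?]; lra.
- move=> p i p2 pi; have := coordQ p i p2; have := coordy i.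
  by rewrite !mxE pi !ler_norml => /andP[? ?] /andP[? ?]; lra.
by exists p => //; apply/eqP; rewrite -subr_eq0 Qpy.
Qed.

(** * The higher chain rule *)

(** The property of a family of derivatives whose existence defines smoothness:
    [D x [:: v1; ...; vk]] is the k-th derivative of [F] at [x] in the directions
    v1, ..., vk. *)
Definition derivative_tower (R : realType) (X Y : normedModType R)
    (F : X -> Y) (D : X -> seq X -> Y) : Prop :=
    [/\ forall x, D x [::] = F x,
        forall x s1 s2, linear (fun u => D x (s1 ++ u :: s2)),
        forall x k, exists C : R, forall v, size v = k ->
          `|D x v| <= C * \prod_(u <- v) `|u|
      & forall x k (e : R), 0 < e -> \forall h \near (0 : X),
          forall v, size v = k ->
          `|D (x + h) v - D x v - D x (h :: v)|
            <= e * `|h| * \prod_(u <- v) `|u|].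

Lemma is_derive_slopeP (R : realType) (Y : normedModType R) (f : R -> Y) (t : R) (df : Y) :
  is_derive t 1 f df <-> h^-1 *: (f (h + t) - f t) @[h --> (0:R)^'] --> df.
Proof.
have E : (fun h : R => h^-1 *: ((f \o shift t) (h *: (1 : R)) - f t)) =
         (fun h : R => h^-1 *: (f (h + t) - f t)).
  by apply/funext => h; rewrite /= [_ *: 1]mulr1.
split=> [[+ <-]|df_lim]; first by rewrite /derivable /derive E.
apply: DeriveDef; first by rewrite /derivable E; apply/cvg_ex; exists df.
by rewrite /derive E; apply: cvg_lim.
Qed.

Section Tower.
Variables (R : realType) (X Y : normedModType R).
Variables (F : X -> Y) (D : X -> seq X -> Y).
Hypothesis DF : derivative_tower F D.

Let linD x s1 s2 : linear (fun u => D x (s1 ++ u :: s2)).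
Proof. by case: DF. Qed.

Lemma towerD x s1 s2 u v :
  D x (s1 ++ (u + v) :: s2) = D x (s1 ++ u :: s2) + D x (s1 ++ v :: s2).
Proof. by have := linD x s1 s2 1 u v; rewrite !scale1r. Qed.

Lemma tower0 x s1 s2 : D x (s1 ++ 0 :: s2) = 0.
Proof.
have h := towerD x s1 s2 0 0; rewrite addr0 in h.
by apply: (addrI (D x (s1 ++ 0 :: s2))); rewrite -h addr0.
Qed.

Lemma towerZ x s1 s2 a u : D x (s1 ++ (a *: u) :: s2) = a *: D x (s1 ++ u :: s2).
Proof. by have := linD x s1 s2 a u 0; rewrite addr0 tower0 addr0. Qed.

Lemma towerB x s1 s2 u v :
  D x (s1 ++ (u - v) :: s2) = D x (s1 ++ u :: s2) - D x (s1 ++ v :: s2).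
Proof. by rewrite towerD -[in LHS]scaleN1r towerZ scaleN1r. Qed.

Lemma tower_bound x k : exists2 C : R, 0 <= C & forall v, size v = k ->
  `|D x v| <= C * \prod_(u <- v) `|u|.
Proof.
have [_ _ bnd _] := DF; have [C hC] := bnd x k; exists `|C| => // v sv.
apply: le_trans (hC v sv) _; apply: ler_wpM2r; last exact: ler_norm.
exact: prodr_ge0.
Qed.

Lemma cvg_prod_norm (I T : Type) (G : set_system T) {FG : Filter G}
    (c : I -> T -> X) (l : I -> X) (s : seq I) :
  (forall i, c i t @[t --> G] --> l i) ->
  \prod_(u <- [seq c i t | i <- s]) `|u| @[t --> G] -->
     \prod_(u <- [seq l i | i <- s]) `|u|.
Proof.
move=> cl; elim: s => [|i s IH] /=.
  by under eq_cvg do rewrite big_nil; rewrite big_nil; apply: cvg_cst.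
under eq_cvg do rewrite big_cons; rewrite big_cons.
by apply: cvgM => //; apply: cvg_norm; apply: cl.
Qed.

(** Bounded multilinear maps are jointly continuous: the entries are replaced by
    their limits one at a time, the prefix [p] collecting those already
    treated.  The entries are indexed by an arbitrary type so that difference
    quotients can be mixed with values of the curve. *)
Lemma tower_cvg (I T : Type) (G : set_system T) {FG : Filter G}
    (c : I -> T -> X) (l : I -> X) (x : X) (p : seq X) (s : seq I) :
  (forall i, c i t @[t --> G] --> l i) ->
  D x (p ++ [seq c i t | i <- s]) @[t --> G] --> D x (p ++ [seq l i | i <- s]).
Proof.
move=> cl; elim: s p => [|i s IH] p /=; first exact: cvg_cst.
have -> : (fun t => D x (p ++ c i t :: [seq c i t | i <- s])) =
   (fun t => D x ((p ++ [:: l i]) ++ [seq c i t | i <- s]) +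
     D x (p ++ (c i t - l i) :: [seq c i t | i <- s])).
  by apply/funext => t; rewrite -catA -towerD addrC subrK.
have -> : p ++ l i :: [seq l i | i <- s] = (p ++ [:: l i]) ++ [seq l i | i <- s].
  by rewrite -catA.
rewrite -[X in _ --> X]addr0; apply: cvgD; first exact: IH.
have [C C0 hC] := tower_bound x (size p + (size s).+1).
apply/norm_cvg0P.
pose bnd t := C * (\prod_(u <- p) `|u| *
   (`|c i t - l i| * \prod_(u <- [seq c i t | i <- s]) `|u|)).
have bnd0 : bnd t @[t --> G] --> (0 : R).
  rewrite -[X in _ --> X](mulr0 C); apply: cvgM; first exact: cvg_cst.
  rewrite -[X in _ --> X](mulr0 (\prod_(u <- p) `|u|)).
  apply: cvgM; first exact: cvg_cst.
  rewrite -[X in _ --> X](mul0r (\prod_(u <- [seq l i | i <- s]) `|u|)).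
  apply: cvgM; last exact: cvg_prod_norm.
  by apply/norm_cvg0P; apply/subr_cvg0.
apply: (squeeze_cvgr _ (cvg_cst 0) bnd0); apply: nearW => t.
rewrite normr_ge0 /=; apply: le_trans (hC _ _) _.
  by rewrite size_cat /= size_map.
by rewrite big_cat big_cons.
Qed.

Lemma tower_remainder x k (e : R) : 0 < e -> \forall h \near (0 : X),
  forall v, size v = k ->
    `|D (x + h) v - D x v - D x (h :: v)| <= e * `|h| * \prod_(u <- v) `|u|.
Proof. by case: DF => _ _ _; apply. Qed.

(** The Leibniz rule on index lists: all ways to differentiate exactly one of
    the entries. *)
Fixpoint raise (s : seq nat) : seq (seq nat) :=
  if s is a :: s' then (a.+1 :: s') :: [seq a :: r | r <- raise s'] else [::].

Section Curve.
Variable c : nat -> R -> X.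
Hypothesis dc : forall j (t : R), is_derive t 1 (c j) (c j.+1 t).

Let dcc j t : h^-1 *: (c j (h + t) - c j t) @[h --> (0:R)^'] --> c j.+1 t.
Proof. exact/is_derive_slopeP. Qed.

Let cc j t : c j (h + t) @[h --> (0:R)^'] --> c j t.
Proof.
have [/derivable1_diffP/differentiable_continuous cj _] := dc j t.
exact/(@continuous_withinNshiftx _ R^o).
Qed.

(** Leibniz rule for a multilinear map with fixed base point: the increment of
    the first entry enters linearly, the others are left to the induction. *)
Lemma tower_slope x p s t :
  h^-1 *: (D x (p ++ [seq c j (h + t) | j <- s]) - D x (p ++ [seq c j t | j <- s]))
    @[h --> (0:R)^'] --> \sum_(r <- raise s) D x (p ++ [seq c j t | j <- r]).
Proof.
elim: s p => [|a s IH] p /=.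
  rewrite big_nil; under eq_cvg do rewrite subrr scaler0; exact: cvg_cst.
rewrite big_cons big_map /=.
have -> : (fun h : R => h^-1 *: (D x (p ++ c a (h + t) :: [seq c j (h + t) | j <- s]) -
       D x (p ++ c a t :: [seq c j t | j <- s]))) = (fun h =>
  D x (p ++ (h^-1 *: (c a (h + t) - c a t)) :: [seq c j (h + t) | j <- s]) +
  h^-1 *: (D x ((p ++ [:: c a t]) ++ [seq c j (h + t) | j <- s]) -
       D x ((p ++ [:: c a t]) ++ [seq c j t | j <- s]))).
  apply/funext => h; rewrite towerZ towerB -!catA /= -scalerDr; congr (_ *: _).
  by rewrite addrA subrK.
apply: cvgD; last first.
  rewrite (eq_bigr (fun r => D x ((p ++ [:: c a t]) ++ [seq c j t | j <- r]))) => [|r _].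
    exact: IH.
  by rewrite -catA.
pose C (i : option nat) (h : R) := if i is Some j then c j (h + t)
  else h^-1 *: (c a (h + t) - c a t).
pose l (i : option nat) := if i is Some j then c j t else c a.+1 t.
have cl i : C i h @[h --> (0:R)^'] --> l i by case: i => [j|]; [apply: cc|apply: dcc].
have := tower_cvg (G := (0:R)^') (x := x) (p := p) (s := None :: map Some s) cl.
by rewrite /= -map_comp; under eq_fun do rewrite -map_comp; apply.
Qed.

(** When the base point also moves along the curve, differentiability of
    [D _ (V h)] adds the term with one more entry, the velocity [c 1]; its
    remainder is small because it is so uniformly in the arguments [V h], which
    stay bounded. *)
Lemma tower_curve_slope s t :
  h^-1 *: (D (c 0%N (h + t)) [seq c j (h + t) | j <- s] -
           D (c 0%N t) [seq c j t | j <- s]) @[h --> (0:R)^'] -->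
  \sum_(r <- (1%N :: s) :: raise s) D (c 0%N t) [seq c j t | j <- r].
Proof.
rewrite big_cons /=.
set x := c 0%N t; pose k h := c 0%N (h + t) - x; pose V h := [seq c j (h + t) | j <- s].
have -> : (fun h : R => h^-1 *: (D (c 0%N (h + t)) [seq c j (h + t) | j <- s] -
           D x [seq c j t | j <- s])) = (fun h =>
   h^-1 *: (D (x + k h) (V h) - D x (V h) - D x (k h :: V h)) +
   D x ((h^-1 *: k h) :: V h) +
   h^-1 *: (D x (V h) - D x [seq c j t | j <- s])).
  apply/funext => h; rewrite (towerZ x [::]) -!scalerDr; congr (_ *: _).
  have -> : x + k h = c 0%N (h + t) by rewrite /k addrC subrK.
  by rewrite subrK addrA subrK.
apply: cvgD; last exact: (tower_slope (p := [::])).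
pose C (i : option nat) (h : R) := if i is Some j then c j (h + t)
  else h^-1 *: k h.
pose l (i : option nat) := if i is Some j then c j t else c 1%N t.
have cl i : C i h @[h --> (0:R)^'] --> l i by case: i => [j|]; [apply: cc|apply: dcc].
rewrite -[X in _ --> X]add0r; apply: cvgD; last first.
  have := tower_cvg (G := (0:R)^') (x := x) (p := [::]) (s := None :: map Some s) cl.
  by rewrite /= -map_comp; under eq_fun do rewrite -map_comp; apply.
have kc : k h @[h --> (0:R)^'] --> 0 by apply/subr_cvg0; apply: cc.
pose B h := \prod_(u <- [seq C i h | i <- None :: map Some s]) `|u|.
have BE h : B h = `|h^-1 *: k h| * \prod_(u <- V h) `|u|.
  by rewrite /B /= big_cons -map_comp.
have := cvg_prod_norm (G := (0:R)^') (s := None :: map Some s) cl.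
set b := \prod_(_ <- _) _ => /(_ _) cB.
have b0 : 0 <= b by exact: prodr_ge0.
apply/cvgr0Pnorm_le => e e0.
have e'0 : 0 < e / (b + 1) by rewrite divr_gt0// ltr_wpDl.
near=> h; rewrite normrZ.
have h1 : `|D (x + k h) (V h) - D x (V h) - D x (k h :: V h)| <=
     e / (b + 1) * `|k h| * \prod_(u <- V h) `|u|.
  have : forall v, size v = size s -> `|D (x + k h) v - D x v - D x (k h :: v)|
            <= (e / (b + 1)) * `|k h| * \prod_(u <- v) `|u|.
    by near: h; apply: (kc _ (@tower_remainder x (size s) _ e'0)).
  by apply; rewrite size_map.
have h2 : B h <= b + 1 by near: h; apply: (cvgr_le b cB); rewrite ltrDl.
apply: le_trans (ler_wpM2l (normr_ge0 _) h1) _.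
have -> : `|h^-1| * (e / (b + 1) * `|k h| * \prod_(u <- V h) `|u|) = e / (b + 1) * B h.
  by rewrite BE normrZ; ring.
apply: le_trans (ler_wpM2l (ltW e'0) h2) _.
by rewrite divfK// gt_eqF// ltr_wpDl.
Unshelve. all: by end_near. Qed.

(** Faa di Bruno's formula with its terms listed, repetitions included: the
    list [:: i_1; ...; i_r] stands for D^r F applied to the derivatives of order
    i_1, ..., i_r of the curve. *)
Definition faa_di_bruno (k : nat) : seq (seq nat) :=
  iter k (fun T => flatten [seq (1%N :: s) :: raise s | s <- T]) [:: [::]].

Definition chain_derivative (k : nat) (t : R) : Y :=
  \sum_(s <- faa_di_bruno k) D (c 0%N t) [seq c j t | j <- s].

Lemma is_derive_chain k (t : R) :
  is_derive t 1 (chain_derivative k) (chain_derivative k.+1 t).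
Proof.
apply/is_derive_slopeP.
rewrite /chain_derivative /= big_flatten big_map /=.
elim: (faa_di_bruno k) => [|s T IH].
  by rewrite !big_nil; under eq_cvg do rewrite !big_nil subrr scaler0; apply: cvg_cst.
rewrite [X in _ --> X]big_cons; under eq_cvg do rewrite !big_cons opprD addrACA scalerDr.
by apply: cvgD => //; apply: tower_curve_slope.
Qed.

Lemma derive1n_tower k : derive1n k (fun t => F (c 0%N t)) = chain_derivative k.
Proof.
elim: k => [|k IH].
  apply/funext => t; rewrite /chain_derivative /= big_seq1.
  by case: DF => ->.
rewrite derive1nS IH; apply/funext => t; rewrite derive1E.
by have := is_derive_chain k t => /@derive_val.
Qed.

End Curve.

End Tower.

(** * Taylor expansion along polynomial curves *)

Section MeanValue.
Variables (R : realType) (m : nat).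

Lemma mean_value_bound (f df : R -> 'rV[R]_m) (C T : R) :
  0 <= T -> (forall t : R, is_derive t 1 f (df t)) -> f 0 = 0 ->
  (forall t, 0 <= t <= T -> `|df t| <= C) -> `|f T| <= C * T.
Proof.
move=> T0 fdf f0 dfC.
have C0 : 0 <= C by apply: le_trans (dfC 0 _) => //; rewrite lexx.
apply/row_norm_leP => [|i]; first exact: mulr_ge0.
have fdfi (t : R) : is_derive t 1 (fun t => f t ord0 i) (df t ord0 i).
  apply/is_derive_slopeP.
  have := fdf t => /is_derive_slopeP fdft.
  rewrite (_ : (fun h : R => _) = (fun M : 'rV[R]_m => M ord0 i) \o
     (fun h : R => h^-1 *: (f (h + t) - f t))); last first.
    by apply/funext => h; rewrite /= !mxE.
  exact: (continuous_cvg _ (@coord_continuous R 1 m ord0 i (df t)) fdft).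
have cf : {within `[0, T], continuous (fun t => f t ord0 i)}.
  apply: continuous_subspaceT => t.
  by have [/derivable1_diffP/differentiable_continuous] := fdfi t.
have [c] := MVT_segment T0 (fun t _ => fdfi t) cf.
rewrite in_itv /= f0 mxE !subr0 => cT ->; rewrite normrM (ger0_norm T0).
apply: ler_wpM2r => //; have := dfC c cT.
by move/row_norm_leP; apply.
Qed.

End MeanValue.

Section PolyCurve.
Variables (R : realType) (X : normedModType R).

(** With [v i = 0] for [i > n], this is the [j]-th derivative of the curve
    t |-> sum_i t^i / i! v_i. *)
Definition poly_curve (n : nat) (v : nat -> X) (j : nat) (t : R) : X :=
  \sum_(i < n.+1) (t ^+ i / i`!%:R) *: v (i + j)%N.

Lemma poly_curve0 n v j : poly_curve n v j 0 = v j.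
Proof.
rewrite /poly_curve big_ord_recl big1 ?addr0 => [|i _].
  by rewrite expr0 fact0 invr1 mulr1 scale1r.
by rewrite lift0 expr0n mul0r scale0r.
Qed.

Lemma is_derive_divided_power (i : nat) (t : R) :
  is_derive t 1 (fun t : R => t ^+ i.+1 / i.+1`!%:R) (t ^+ i / i`!%:R).
Proof.
have := is_deriveZ (i.+1`!%:R^-1) (is_deriveX i.+1 (is_derive_id t (1:R))).
rewrite [_ *: 1]mulr1 /= => h.
have -> : (fun t : R => t ^+ i.+1 / i.+1`!%:R) = (i.+1)`!%:R^-1 \*: id ^+ i.+1.
  by apply/funext => u; rewrite /= exprfctE mulrC.
move: h; congr is_derive.
rewrite factS natrM invfM [_ *: _]mulrACA.
by rewrite mulrC mulVf ?mulr1 ?pnatr_eq0// mulrC.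
Qed.

Lemma is_derive_scalel (f : R -> R) (t df : R) (x : X) :
  is_derive t 1 f df -> is_derive t 1 (fun t => f t *: x) (df *: x).
Proof.
move=> /(is_derive_slopeP (Y := R^o)) fdf; apply/is_derive_slopeP.
have -> : (fun h : R => h^-1 *: (f (h + t) *: x - f t *: x)) =
          (fun h : R => (h^-1 *: (f (h + t) - f t)) *: x).
  by apply/funext => h; rewrite -scalerBl scalerA.
exact: (cvgZr_tmp (a := x) fdf).
Qed.

Lemma is_derive_poly_curve n v j (t : R) : (forall i, (n < i)%N -> v i = 0) ->
  is_derive t 1 (poly_curve n v j) (poly_curve n v j.+1 t).
Proof.
move=> v0.
pose df (i : nat) : R := if i is k.+1 then t ^+ k / k`!%:R else 0.
have dfP (i : 'I_n.+1) : is_derive t 1 (fun t : R => (t ^+ i / i`!%:R) *: v (i + j)%N)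
    (df i *: v (i + j)%N).
  apply: is_derive_scalel; case: i => -[|k] kn /=; last exact: is_derive_divided_power.
  by under eq_fun do rewrite expr0; apply: is_derive_cst.
have -> : poly_curve n v j.+1 t = \sum_(i < n.+1) df i *: v (i + j)%N.
  rewrite [RHS]big_ord_recl /= scale0r add0r /poly_curve big_ord_recr /=.
  rewrite v0 ?scaler0 ?addr0; last by rewrite addnS ltnS leq_addr.
  by apply: eq_bigr => i _; rewrite /df /= /bump add1n addSnnS.
have -> : poly_curve n v j = \sum_(i < n.+1) (fun t : R => (t ^+ i / i`!%:R) *: v (i + j)%N).
  by apply/funext => u; rewrite fct_sumE.
exact: is_derive_sum.
Qed.

End PolyCurve.

Lemma raise_sum s r : r \in raise s -> sumn r = (sumn s).+1.
Proof.
elim: s r => //= a s IH r; rewrite inE => /orP[/eqP ->//|/mapP[r' /IH r's ->]] /=.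
by rewrite r's addnS.
Qed.

Lemma faa_di_bruno_sum k s : s \in faa_di_bruno k -> sumn s = k.
Proof.
elim: k s => [|k IH] s; first by rewrite inE => /eqP ->.
rewrite /= => /flattenP[_ /mapP[r /IH <- ->]]; rewrite inE => /orP[/eqP ->//|].
exact: raise_sum.
Qed.

Lemma mem_leq_sumn s j : j \in s -> (j <= sumn s)%N.
Proof.
elim: s => //= a s IH; rewrite inE => /orP[/eqP ->|/IH]; first exact: leq_addr.
by move/leq_trans; apply; apply: leq_addl.
Qed.

Lemma raise_leq k s r : all (leq^~ k) s -> r \in raise s -> all (leq^~ k.+1) r.
Proof.
elim: s r => //= a s IH r /andP[ak sk]; rewrite inE => /orP[/eqP ->|/mapP[r' r's ->]] /=.
  by rewrite ltnS ak /=; apply: sub_all sk => x /= /leqW.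
by rewrite (leqW ak) IH.
Qed.

(** The top derivative of the curve occurs only in the first order term: the
    step from k to k.+1 produces one list [:: k.+2] out of [:: k.+1], and raises
    all other indices to at most k.+1. *)
Lemma faa_di_bruno_top k : exists2 T : seq (seq nat),
  perm_eq (faa_di_bruno k.+1) ([:: k.+1] :: T) & all (all (leq^~ k)) T.
Proof.
elim: k => [|k [T permT leqT]]; first by exists [::].
exists ([:: 1%N; k.+1] :: flatten [seq (1%N :: s) :: raise s | s <- T]).
  apply: perm_trans (perm_flatten (perm_map _ permT)) _.
  by rewrite /=; apply/seq.permP => a /=; rewrite addnCA.
apply/andP; split; first by rewrite /= leqnn.
apply/allP => r /flattenP[_ /mapP[s sT ->]].
have sk := allP leqT _ sT.
rewrite inE => /orP[/eqP ->/=|]; last exact: raise_leq.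
by apply: sub_all sk => x /= /leqW.
Qed.

Section Taylor.
Variables (R : realType) (m : nat).

(** Integration of a Taylor estimate, by the mean value inequality. *)
Lemma taylor_step (f df : R -> 'rV[R]_m) (a : 'rV[R]_m) (C T : R) (j k : nat) :
  0 <= C -> (forall t : R, is_derive t 1 f (df t)) -> f 0 = 0 ->
  (forall t, 0 <= t <= T -> `|df t - (t ^+ k / k`!%:R) *: a| <= C * t ^+ j) ->
  forall t, 0 <= t <= T -> `|f t - (t ^+ k.+1 / k.+1`!%:R) *: a| <= C * t ^+ j.+1.
Proof.
move=> C0 fdf f0 dfC t /andP[t0 tT].
pose g (u : R) := f u - (u ^+ k.+1 / k.+1`!%:R) *: a.
pose dg (u : R) := df u - (u ^+ k / k`!%:R) *: a.
have gdg (u : R) : is_derive u 1 g (dg u).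
  by apply: is_deriveB; apply: is_derive_scalel; apply: is_derive_divided_power.
have g0 : g 0 = 0 by rewrite /g f0 expr0n mul0r scale0r subrr.
rewrite [t ^+ j.+1]exprSr mulrA; apply: (mean_value_bound t0 gdg g0) => u /andP[u0 ut].
apply: le_trans (dfC u _) _; first by rewrite u0 (le_trans ut).
by apply: ler_wpM2l => //; rewrite lerXn2r.
Qed.

Lemma taylor_bound (f : nat -> R -> 'rV[R]_m) (n : nat) (C T : R) :
  (0 < n)%N -> 0 <= C -> (forall k (t : R), is_derive t 1 (f k) (f k.+1 t)) ->
  (forall k, (0 < k < n)%N -> f k 0 = 0) ->
  (forall t, 0 <= t <= T -> `|f n.+1 t| <= C) ->
  forall t, 0 <= t <= T ->
    `|f 0%N t - f 0%N 0 - (t ^+ n / n`!%:R) *: f n 0| <= C * t ^+ n.+1.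
Proof.
move=> n0 C0 df f0 fC.
have dfc k (t : R) : is_derive t 1 (fun t => f k t - f k 0) (f k.+1 t).
  by rewrite -[f k.+1 t]subr0; apply: is_deriveB.
suff H i k : (k + i.+1 = n)%N -> forall t, 0 <= t <= T ->
    `|f k t - f k 0 - (t ^+ i.+1 / i.+1`!%:R) *: f n 0| <= C * t ^+ i.+2.
  by case: n n0 H {f0 fC} => // n _ H; apply: H.
elim: i k => [|i IH] k kn; apply: (taylor_step C0 (dfc k)); rewrite ?subrr//.
  move: kn; rewrite addn1 => -> t tT; rewrite expr0 fact0 invr1 mulr1 scale1r expr1.
  apply: (mean_value_bound _ (dfc n)); rewrite ?subrr//; first by case/andP: tT.
  move=> u /andP[u0 ut]; apply: fC; rewrite u0 (le_trans ut)//.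
  by case/andP: tT.
move=> t tT; have := IH k.+1 _ t tT.
by rewrite (f0 k.+1) ?subr0; [apply; lia|lia].
Qed.

End Taylor.

Section Uniform.
Variables (R : realType) (X : normedModType R) (m : nat).
Variables (F : X -> 'rV[R]_m) (D : X -> seq X -> 'rV[R]_m).
Hypothesis DF : derivative_tower F D.

(** Differentiability of the k-th derivative at 0, uniformly in its arguments,
    gives a common bound near 0. *)
Lemma tower_locally_bounded (k : nat) : exists2 C : R, 0 <= C &
  \forall x \near (0 : X), forall v, size v = k ->
    `|D x v| <= C * \prod_(u <- v) `|u|.
Proof.
have [C0 C00 hC0] := tower_bound DF 0 k.
have [C1 C10 hC1] := tower_bound DF 0 k.+1.
exists (C0 + C1 + 1); first by rewrite !addr_ge0.
near=> x.
have x1 : `|x| <= 1 by near: x; apply: (cvgr0_norm_le _ cvg_id).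
have hx : forall v, size v = k ->
   `|D (0 + x) v - D 0 v - D 0 (x :: v)| <= 1 * `|x| * \prod_(u <- v) `|u|.
  by near: x; apply: (tower_remainder DF 0 k ltr01).
move=> v sv; have h := hx v sv.
have h0 := hC0 v sv.
have := hC1 (x :: v); rewrite /= sv big_cons => /(_ erefl) h1.
have P0 : 0 <= \prod_(u <- v) `|u| by exact: prodr_ge0.
rewrite add0r mul1r in h.
have -> : D x v = (D x v - D 0 v - D 0 (x :: v)) + D 0 v + D 0 (x :: v).
  by rewrite addrAC subrK subrK.
apply: le_trans (ler_normD _ _) _; apply: le_trans (lerD (ler_normD _ _) h1) _.
rewrite mulrDl mulrDl mul1r [_ + \prod_(u <- v) `|u|]addrC addrA.
apply: lerD; last by rewrite ler_wpM2l// ler_piMl.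
by apply: lerD => //; apply: le_trans h _; rewrite ler_piMl.
Unshelve. all: by end_near. Qed.

Lemma prod_norm_map (c : nat -> X) (K : R) (s : seq nat) : 0 <= K ->
  (forall j, `|c j| <= K) -> \prod_(u <- [seq c j | j <- s]) `|u| <= K ^+ size s.
Proof.
move=> K0 cK; elim: s => [|a s IH] /=; first by rewrite big_nil.
by rewrite big_cons exprS; apply: ler_pM => //; apply: prodr_ge0.
Qed.

Lemma tower_sum_bounded (T : seq (seq nat)) (K : R) : 0 <= K ->
  exists2 C : R, 0 <= C & \forall x \near (0 : X), forall c : nat -> X,
    (forall j, `|c j| <= K) -> `|\sum_(s <- T) D x [seq c j | j <- s]| <= C.
Proof.
move=> K0; elim: T => [|s T [C C0 hC]].
  by exists 0 => //; near=> x => c _; rewrite big_nil normr0.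
have [C1 C10 hC1] := tower_locally_bounded (size s).
exists (C1 * K ^+ size s + C); first by rewrite addr_ge0// mulr_ge0// exprn_ge0.
near=> x.
have hx1 : forall v, size v = size s -> `|D x v| <= C1 * \prod_(u <- v) `|u|.
  by near: x.
have hx : forall c : nat -> X,
    (forall j, `|c j| <= K) -> `|\sum_(s <- T) D x [seq c j | j <- s]| <= C by near: x.
move=> c cK; rewrite big_cons; apply: le_trans (ler_normD _ _) _.
apply: lerD; last exact: hx.
apply: le_trans (hx1 _ _) _; first by rewrite size_map.
by apply: ler_wpM2l => //; apply: prod_norm_map.
Unshelve. all: by end_near. Qed.

Lemma poly_curve_bound (n : nat) (v : nat -> X) (M : R) (j : nat) (t : R) :
  (forall i, `|v i| <= M) -> 0 <= t <= 1 -> `|poly_curve n v j t| <= n.+1%:R * M.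
Proof.
move=> vM /andP[t0 t1]; apply: le_trans (ler_norm_sum _ _ _) _.
rewrite mulr_natl -[n.+1 in X in _ <= X]card_ord -sumr_const; apply: ler_sum => i _.
rewrite normrZ -[M]mul1r; apply: ler_pM => //.
rewrite ger0_norm ?divr_ge0 ?exprn_ge0//.
rewrite ler_pdivrMr ?ltr0n ?fact_gt0// mul1r.
by apply: (@le_trans _ _ 1); [exact: exprn_ile1|rewrite ler1n fact_gt0].
Qed.

Lemma poly_curve_small (n : nat) (v : nat -> X) (M : R) (t : R) :
  v 0%N = 0 -> (forall i, `|v i| <= M) -> 0 <= t <= 1 ->
  `|poly_curve n v 0 t| <= t * (n.+1%:R * M).
Proof.
move=> v0 vM /andP[t0 t1]; apply: le_trans (ler_norm_sum _ _ _) _.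
rewrite mulrCA mulr_natl -[n.+1 in X in _ <= X]card_ord -sumr_const; apply: ler_sum => i _.
have M0 : 0 <= M by apply: le_trans (vM 0%N).
case: i => -[|i] _ /=; first by rewrite v0 scaler0 normr0 mulr_ge0.
rewrite normrZ; apply: ler_pM => //.
rewrite ger0_norm ?divr_ge0 ?exprn_ge0//.
rewrite ler_pdivrMr ?ltr0n ?fact_gt0// exprS ler_wpM2l//.
by apply: (@le_trans _ _ 1); [exact: exprn_ile1|rewrite ler1n fact_gt0].
Qed.

(** The [k]-th derivative at 0 of t |-> F(sum_i t^i / i! v_i), when [v 0 = 0]. *)
Definition taylor_coef (k : nat) (v : nat -> X) : 'rV[R]_m :=
  \sum_(s <- faa_di_bruno k) D 0 [seq v j | j <- s].

Lemma chain_derivative_poly k n v : v 0%N = 0 ->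
  chain_derivative D (poly_curve n v) k 0 = taylor_coef k v.
Proof.
move=> v0; rewrite /chain_derivative poly_curve0 v0; apply: eq_bigr => s _.
by under eq_map do rewrite poly_curve0.
Qed.

(** The constant depends on the curve only through the bound [M] on its
    coefficients: for small t the curve stays in a ball where the derivatives
    of order at most n.+1 of F are bounded. *)
Lemma uniform_taylor (n : nat) (M : R) : (0 < n)%N -> 0 <= M ->
  exists2 C : R, 0 <= C & \forall t \near (0 : R)^'+, forall v : nat -> X,
    v 0%N = 0 -> (forall i, (n < i)%N -> v i = 0) -> (forall i, `|v i| <= M) ->
    (forall k, (0 < k < n)%N -> taylor_coef k v = 0) ->
    `|F (poly_curve n v 0 t) - F 0 - (t ^+ n / n`!%:R) *: taylor_coef n v|
       <= C * t ^+ n.+1.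
Proof.
move=> n0 M0; have K0 : 0 <= n.+1%:R * M by rewrite mulr_ge0.
have [C C0 hC] := tower_sum_bounded (faa_di_bruno n.+1) K0.
exists C => //.
have [d /= d0 hd] := (iffLR (nbhs_ballP _ _)) hC.
near=> t => v v0 vn vM coef0.
have t0 : 0 <= t by [].
have t1 : t <= 1 by near: t; apply: nbhs_right_le.
have td : t * (n.+1%:R * M) < d.
  have : t < d / (n.+1%:R * M + 1).
    by near: t; apply: nbhs_right_lt; rewrite divr_gt0// ltr_wpDl.
  rewrite ltr_pdivlMr ?ltr_wpDl// mulrDr; apply: le_lt_trans.
  by rewrite lerDl mulr1.
have dv k (u : R) : is_derive u 1 (chain_derivative D (poly_curve n v) k)
    (chain_derivative D (poly_curve n v) k.+1 u).
  by apply: (is_derive_chain DF) => j w; apply: is_derive_poly_curve.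
have coefE k := chain_derivative_poly k n v0.
have := taylor_bound n0 C0 dv _ _ (t := t) (T := t).
rewrite (coefE n) /chain_derivative /= !big_seq1 /=.
have D0 x : D x [::] = F x by case: DF.
rewrite !D0 poly_curve0 v0 => -> //; last by rewrite t0 lexx.
- move=> k kn; apply: etrans (coef0 k kn); apply: eq_bigr => s _.
  by under eq_map do rewrite poly_curve0.
- move=> u /andP[u0 ut]; have u1 : u <= 1 := le_trans ut t1.
  apply: hd => [|j]; last by apply: poly_curve_bound => //; rewrite u0.
  rewrite -ball_normE /= sub0r normrN; apply: le_lt_trans td.
  apply: le_trans (poly_curve_small n v0 vM _) _; first by rewrite u0.
  by rewrite ler_wpM2r.
Unshelve. all: by end_near. Qed.

End Uniform.

Section CurveDiff.
Variables (R : realType) (X : normedModType R) (m : nat).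
Variables (F : X -> 'rV[R]_m) (D : X -> seq X -> 'rV[R]_m).
Hypothesis DF : derivative_tower F D.

(** The vectors v_1, ..., v_k as a sequence indexed from 1 and extended by 0. *)
Definition jet (k : nat) (v : 'rV[X]_k) (i : nat) : X :=
  if i is j.+1 then oapp (v ord0) 0 (insub j) else 0.

Lemma jetE k (v : 'rV[X]_k) (i : 'I_k) : jet v i.+1 = v ord0 i.
Proof. by rewrite /jet valK. Qed.

Lemma jet_out k (v : 'rV[X]_k) i : (k < i)%N -> jet v i = 0.
Proof. by case: i => //= i ki; rewrite insubF// ltnNge -ltnS ki. Qed.

Lemma curve_diff_coef k (v : 'rV[X]_k) : curve_diff F v = taylor_coef D k (jet v).
Proof.
rewrite -(chain_derivative_poly D k k (v := jet v))//.
have dpc j (t : R) : is_derive t 1 (poly_curve k (jet v) j) (poly_curve k (jet v) j.+1 t).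
  by apply: is_derive_poly_curve; apply: jet_out.
rewrite -(derive1n_tower DF dpc).
congr (derive1n k _ 0); apply/funext => t; congr F.
rewrite /poly_curve big_ord_recl /= scaler0 add0r; apply: eq_bigr => i _.
by rewrite /bump add1n add0n addn0 valK.
Qed.

Lemma taylor_coef_eq k (u v : nat -> X) : (forall i, (i <= k)%N -> u i = v i) ->
  taylor_coef D k u = taylor_coef D k v.
Proof.
move=> uv; apply: eq_big_seq => s sk; congr (D 0 _).
apply/eq_in_map => j js; apply: uv.
by rewrite -(faa_di_bruno_sum sk) mem_leq_sumn.
Qed.

(** The last coefficient contributes the first derivative of F and nothing
    else, which is why an intrinsic differential is well defined modulo the
    image of the first derivative. *)
Lemma taylor_coef_top k (u v : nat -> X) : (forall i, (i <= k)%N -> u i = v i) ->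
  taylor_coef D k.+1 u - D 0 [:: u k.+1] = taylor_coef D k.+1 v - D 0 [:: v k.+1].
Proof.
move=> uv; have [T permT leqT] := faa_di_bruno_top k.
rewrite /taylor_coef !(perm_big _ permT) /= !big_cons /=.
rewrite addrAC subrr add0r addrAC subrr add0r.
apply: eq_big_seq => s sT; congr (D 0 _).
apply/eq_in_map => j js; apply: uv.
exact: (allP (allP leqT s sT)).
Qed.

End CurveDiff.

(** * Continuity lemmas and a section of the differential *)

Lemma matrix_coord_cvg (T : topologicalType) (k l : nat) (i : 'I_k) (j : 'I_l) :
  continuous (fun M : 'M[T]_(k, l) => M i j).
Proof.
move=> M A MA.
exists (fun i' j' => if (i' == i) && (j' == j) then A else setT).
  by move=> i' j'; case: ifP => [/andP[/eqP -> /eqP ->]//|_]; apply: filterT.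
by move=> M' /(_ i j); rewrite /= !eqxx.
Qed.

Lemma row_cvg (R : realType) (T : Type) (G : set_system T) {FG : Filter G} (k : nat)
    (f : T -> 'rV[R]_k) (a : 'rV[R]_k) :
  (forall i, f x ord0 i @[x --> G] --> a ord0 i) -> f x @[x --> G] --> a.
Proof.
move=> fa; apply/cvgrPdist_le => e e0.
have h i : \forall x \near G, `|a ord0 i - f x ord0 i| <= e.
  by move: (fa i) => /cvgrPdist_le; apply.
apply: (filterS _ (filter_forall _ h)) => x hx.
apply/row_norm_leP => [|i]; first exact: ltW.
by rewrite !mxE.
Qed.

Lemma cvg_powR_norm (R : realType) (a x : R) : 0 < a ->
  `|y| `^ a @[y --> x] --> `|x| `^ a.
Proof.
move=> a0; have [->|x0] := eqVneq x 0.
  rewrite normr0 powR0 ?gt_eqF//; apply/cvgr0Pnorm_le => e e0.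
  have h : \forall y \near (0 : R), 0 < y -> `|y `^ a| <= e.
    exact: (@cvgr0_norm_le _ _ _ _ _ _ (powR_cvg0 a0) e e0).
  have n0 : `|y| @[y --> (0 : R)] --> (0 : R).
    by rewrite -[X in _ --> X](@normr0 _ R); apply: norm_continuous.
  have h' : \forall y \near (0 : R), 0 < `|y| -> `| `|y| `^ a| <= e by exact: (n0 _ h).
  apply: (filterS _ h') => y hy.
  have [->|y0] := eqVneq y 0; last by apply: hy; rewrite normr_gt0.
  by rewrite normr0 powR0 ?gt_eqF// normr0 ltW.
apply: (@cvg_comp _ _ _ (fun y : R => `|y|) (fun z : R => z `^ a) (nbhs x) (nbhs `|x|)).
  exact: norm_continuous.
have x0' : 0 < `|x| by rewrite normr_gt0.
by have [/derivable1_diffP/differentiable_continuous] := is_derive1_powR a x0'.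
Qed.

Lemma cvg_signed_root (R : realType) (a x : R) : 0 < a ->
  Num.sg y * `|y| `^ a @[y --> x] --> Num.sg x * `|x| `^ a.
Proof.
move=> a0; have [->|x0] := eqVneq x 0.
  rewrite sgr0 mul0r; apply/norm_cvg0P.
  have h := @cvg_powR_norm R a 0 a0; rewrite normr0 powR0 ?gt_eqF// in h.
  apply: (squeeze_cvgr _ (cvg_cst 0) h); apply: nearW => y.
  rewrite normr_ge0 /= normrM (ger0_norm (powR_ge0 _ _)).
  by rewrite ler_piMl ?powR_ge0// normr_sg lern1 leq_b1.
apply: cvg_trans (cvgM (cvg_cst (Num.sg x)) (@cvg_powR_norm R a x a0)).
apply: near_eq_cvg; near=> y; congr (_ * _).
have yx : `|x - y| < `|x| by near: y; apply: cvgr_dist_lt => //; rewrite normr_gt0.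
have [xs|xs|xs] := ltrgtP x 0; last by case/eqP: (x0).
- move: yx; rewrite (ltr0_norm xs) ltr_norml => /andP[h1 h2].
  by rewrite !ltr0_sg//; lra.
- move: yx; rewrite (gtr0_norm xs) ltr_norml => /andP[h1 h2].
  by rewrite !gtr0_sg//; lra.
Unshelve. all: by end_near. Qed.

Lemma rootv_continuous (R : realType) (l n : nat) : (0 < n)%N ->
  continuous (@rootv R l n).
Proof.
move=> n0 t; apply: (@row_cvg _ _ (nbhs t) (nbhs_filter t)) => i; rewrite mxE.
under eq_fun do rewrite mxE.
apply: (@cvg_comp _ _ _ (fun t : 'rV[R]_l => t ord0 i)
   (fun y : R => Num.sg y * `|y| `^ n%:R^-1) _ _ _ (@coord_continuous R 1 l ord0 i t)).
by apply: cvg_signed_root; rewrite invr_gt0 ltr0n.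
Qed.

Section Differential.
Variables (R : realType) (X Y : normedModType R) (F : X -> Y) (D : X -> seq X -> Y).
Hypothesis DF : derivative_tower F D.

Lemma tower_linear_bound x : exists2 C : R, 0 <= C & forall u, `|D x [:: u]| <= C * `|u|.
Proof.
have [C C0 hC] := tower_bound DF x 1; exists C => // u.
by have := hC [:: u] erefl; rewrite big_seq1.
Qed.

Lemma tower_diff x : 'd F x = (fun u => D x [:: u]) :> (X -> Y).
Proof.
have linD : linear (fun u => D x [:: u]) by have [_ /(_ x [::] [::])] := DF.
pose dL : {linear X -> Y} := HB.pack (fun u => D x [:: u])
  (GRing.isLinear.Build R X Y *:%R (fun u => D x [:: u]) linD).
have [C C0 hC] := tower_linear_bound x.
apply: (@diff_unique R X Y F dL x).
  apply: bounded_linear_continuous; apply/linear_boundedP.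
  exists C; split; first exact: num_real.
  by move=> s Cs u; apply: le_trans (hC u) _; rewrite ler_wpM2r// ltW.
apply/eqaddoP => e e0.
apply: (filterS _ (tower_remainder DF x 0 e0)) => h /(_ [::] erefl).
have D0 y : D y [::] = F y by case: DF.
rewrite !D0 big_nil mulr1.
have -> // : (F \o shift x - (cst (F x) + dL)) h = F (x + h) - F x - D x [:: h].
by rewrite !fctE /= opprD addrA [h + x]addrC.
Qed.

Lemma tower_continuous : continuous F.
Proof.
move=> x; have [C C0 hC] := tower_linear_bound x.
have D0 y : D y [::] = F y by case: DF.
have : F (x + h) @[h --> 0] --> F x.
  apply/subr_cvg0/norm_cvg0P.
  have bnd0 : (C + 1) * `|h| @[h --> (0 : X)] --> (0 : R).
    rewrite -[X in _ --> X](mulr0 (C + 1)); apply: cvgM; first exact: cvg_cst.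
    by rewrite -(@normr0 _ X); apply: norm_continuous.
  apply: (squeeze_cvgr _ (cvg_cst 0) bnd0).
  apply: (filterS _ (tower_remainder DF x 0 ltr01)) => h /(_ [::] erefl).
  rewrite !D0 big_nil mul1r mulr1 normr_ge0 /= => hle.
  rewrite -[F (x + h) - F x](subrK (D x [:: h])).
  apply: le_trans (ler_normD _ _) _; rewrite mulrDl mul1r addrC.
  exact: lerD.
move=> cF; have : F (x + (y - x)) @[y --> x] --> F x.
  apply: (@cvg_comp _ _ _ (fun y => y - x) (fun h => F (x + h)) _ _ _ _ cF).
  by apply/subr_cvg0; apply: cvg_id.
by under eq_fun do rewrite addrC subrK.
Qed.
End Differential.

Lemma sum_cvg (R : realType) (X : normedModType R) (T : Type) (G : set_system T)
   {FG : Filter G} (I : Type) (r : seq I) (f : I -> T -> X) (a : I -> X) :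
  (forall i, f i x @[x --> G] --> a i) ->
  \sum_(i <- r) f i x @[x --> G] --> \sum_(i <- r) a i.
Proof. by move=> fa; apply: (cvg_big (op := +%R)) => //; exact: add_continuous. Qed.

(** A family of values of [L] of maximal rank spans the image; coordinates in
    this family, read off by a pseudo-inverse matrix, depend linearly on y. *)
Lemma linear_section (R : realType) (X : normedModType R) (m : nat)
    (L : {linear X -> 'rV[R]_m}) :
  exists2 S : 'rV[R]_m -> X, continuous S &
    forall y, (exists x, L x = y) -> L (S y) = y.
Proof.
pose P (k : nat) := `[< exists d (xs : 'I_d -> X),
   \rank (\matrix_(i < d) L (xs i)) = k >].
have P0 : exists k, P k.
  exists 0%N; apply/asboolP; exists 0%N, (fun=> 0).
  by apply/eqP; rewrite -leqn0 rank_leq_row.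
have Pm k : P k -> (k <= m)%N by move=> /asboolP[d [xs <-]]; apply: rank_leq_col.
case: (ex_maxnP P0 Pm) => k /asboolP[d [xs rankB]] kmax.
set B := \matrix_(i < d) L (xs i) in rankB.
have subB x : (L x <= B)%MS.
  pose xs' (i : 'I_(1 + d)) := if fintype.split i is inr j then xs j else x.
  have B'E : \matrix_(i < 1 + d) L (xs' i) = col_mx (L x) B.
    apply/row_matrixP => i; rewrite rowK /xs'.
    by case: split_ordP => j ->; rewrite ?rowKu ?rowKd ?rowK// [j]ord1 row_id.
  have : (\rank (col_mx (L x) B) <= k)%N.
    by apply: kmax; apply/asboolP; exists (1 + d)%N, xs'; rewrite B'E.
  have sB : (B <= col_mx (L x) B)%MS by rewrite -addsmxE addsmxSr.
  rewrite -rankB => le; have := mxrank_leqif_sup sB => -[_].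
  rewrite eqn_leq mxrankS// le => /esym; apply: submx_trans.
  by rewrite -addsmxE addsmxSl.
exists (fun y => \sum_i (y *m pinvmx B) ord0 i *: xs i).
  move=> y; apply: (@sum_cvg _ _ _ (nbhs y) (nbhs_filter y)) => i.
  apply: (@cvgZr_tmp _ _ _ (nbhs y) (nbhs_filter y)); rewrite mxE.
  under eq_fun do rewrite mxE.
  apply: (@sum_cvg R R^o _ (nbhs y) (nbhs_filter y)) => j.
  apply: (@cvgM _ _ (nbhs y) (nbhs_filter y)); last exact: cvg_cst.
  exact: coord_continuous.
move=> y [x Lxy]; have := mulmxKpV (subB x); rewrite Lxy => yE.
rewrite linear_sum -[RHS]yE; move: (y *m _) => z.
rewrite mulmx_sum_row; apply: eq_bigr => i _.
by rewrite linearZ rowK.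
Qed.

Lemma bounded_on_ball (R : realType) (X : normedModType R) (m : nat) (r : R)
    (f : 'rV[R]_m -> X) : continuous f ->
  exists2 M : R, 0 <= M & forall p, `|p| <= r -> `|f p| <= M.
Proof.
move=> cf.
have Kc := @closed_ball_compact R m r.
have := compact_bounded (continuous_compact (continuous_subspaceT cf) Kc).
move=> [M [_ hM]]; exists (`|M| + 1) => // p pr.
apply: (hM (`|M| + 1)); last by exists p.
by apply: le_lt_trans (ler_norm _) _; rewrite ltrDl.
Qed.

(** * Openness *)

(** The topological part of the argument: a continuous family of curves through
    0 along which the Taylor expansion of F starts with (t^n / n!) p. *)
Lemma open_of_approximation (R : realType) (X : normedModType R) (m n : nat)
    (F : X -> 'rV[R]_m) (D : X -> seq X -> 'rV[R]_m) (v : nat -> 'rV[R]_m -> X) :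
  derivative_tower F D -> (0 < n)%N ->
  (forall i, continuous (v i)) ->
  (forall p, v 0%N p = 0) -> (forall p i, (n < i)%N -> v i p = 0) ->
  (forall p k, (0 < k < n)%N -> taylor_coef D k (v ^~ p) = 0) ->
  (forall p, taylor_coef D n (v ^~ p) = p) ->
  forall U : set X, nbhs (0 : X) U -> nbhs (F 0) (F @` U).
Proof.
move=> DF n0 cv v0 vn vk vtop U U0.
have [M M0 vM] : exists2 M : R, 0 <= M & forall p i, `|p| <= 2 -> `|v i p| <= M.
  have /choice[b hb] : forall i, exists b : R, 0 <= b /\ forall p, `|p| <= 2 -> `|v i p| <= b.
    by move=> i; have [b b0 hb] := bounded_on_ball 2 (cv i); exists b.
  exists (\sum_(i < n.+1) b i); first by apply: sumr_ge0 => i _; have [] := hb i.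
  move=> p i p2; have [ni|] := ltnP n i.
    by rewrite vn// normr0; apply: sumr_ge0 => j _; have [] := hb j.
  rewrite -ltnS => ni; rewrite (bigD1 (Ordinal ni))//=.
  apply: le_trans ((hb i).2 p p2) _; rewrite lerDl.
  by apply: sumr_ge0 => j _; have [] := hb j.
have [C C0 hC] := uniform_taylor DF n0 M0.
have [d /= d0 dU] := iffLR (nbhs_ballP _ _) U0.
have [t [t0 t1 td tC hT]] : exists t : R, [/\ 0 < t, t <= 1, t * (n.+1%:R * M) < d,
   C * n`!%:R * t <= 1 & forall p, `|p| <= 2 ->
    `|F (poly_curve n (v ^~ p) 0 t) - F 0 - (t ^+ n / n`!%:R) *: p| <= C * t ^+ n.+1].
  have MM0 : 0 <= n.+1%:R * M by rewrite mulr_ge0.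
  have CC0 : 0 <= C * n`!%:R by rewrite mulr_ge0.
  near (0 : R)^'+ => t; exists t; split.
  - by [].
  - by near: t; apply: nbhs_right_le.
  - have : t < d / (n.+1%:R * M + 1).
      by near: t; apply: nbhs_right_lt; rewrite divr_gt0// ltr_wpDl.
    rewrite ltr_pdivlMr ?ltr_wpDl// mulrDr; apply: le_lt_trans.
    by rewrite lerDl mulr1.
  - have : t < 1 / (C * n`!%:R + 1).
      by near: t; apply: nbhs_right_lt; rewrite divr_gt0// ltr_wpDl.
    rewrite ltr_pdivlMr ?ltr_wpDl// mulrDr mulr1 mulrC => /ltW; apply: le_trans.
    by rewrite lerDl.
  - move=> p p2; rewrite -[X in _ *: X](vtop p).
    have : forall w : nat -> X,
      w 0%N = 0 -> (forall i, (n < i)%N -> w i = 0) -> (forall i, `|w i| <= M) ->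
      (forall k, (0 < k < n)%N -> taylor_coef D k w = 0) ->
      `|F (poly_curve n w 0 t) - F 0 - (t ^+ n / n`!%:R) *: taylor_coef D n w|
         <= C * t ^+ n.+1 by near: t.
    by apply => // [i|i|k]; [exact: vn|exact: vM|exact: vk].
pose c : R := n`!%:R / t ^+ n.
have c0 : 0 < c by rewrite divr_gt0 ?exprn_gt0 ?ltr0n ?fact_gt0.
have cN0 : c != 0 by rewrite gt_eqF.
have ct : c * t ^+ n = n`!%:R by rewrite divfK// expf_neq0// gt_eqF.
have cV : c * (t ^+ n / n`!%:R) = 1.
  by rewrite mulrA ct mulfV// pnatr_eq0 -lt0n fact_gt0.
(* The rescaling that turns the leading term of the expansion into [p]. *)
pose Q p := c *: (F (poly_curve n (v ^~ p) 0 t) - F 0).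
have cQ : continuous Q.
  move=> p; apply: (@cvgZl_tmp _ _ _ (nbhs p) (nbhs_filter p)).
  apply: (@cvgB _ _ _ (nbhs p) (nbhs_filter p)); last exact: cvg_cst.
  apply: (@cvg_comp _ _ _ (fun p => poly_curve n (v ^~ p) 0 t) F (nbhs p) (nbhs (poly_curve n (v ^~ p) 0 t))); last exact: (tower_continuous DF).
  apply: (@sum_cvg _ _ _ (nbhs p) (nbhs_filter p)) => i.
  by apply: (@cvgZl_tmp _ _ _ (nbhs p) (nbhs_filter p)); apply: cv.
have Qp p : `|p| <= 2 -> `|Q p - p| <= 1.
  move=> /hT h.
  have -> : Q p - p = c *: (F (poly_curve n (v ^~ p) 0 t) - F 0 - (t ^+ n / n`!%:R) *: p).
    by rewrite scalerBr scalerA cV scale1r.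
  rewrite normrZ gtr0_norm//.
  apply: le_trans (ler_wpM2l (ltW c0) h) _; apply: le_trans tC.
  by rewrite exprS -ct le_eqVlt; apply/orP; left; apply/eqP; ring.
apply/nbhs_ballP; exists c^-1; first by rewrite /= invr_gt0.
move=> y; rewrite -ball_normE /= => yc.
have [|p p2 Qpy] := near_identity_onto cQ Qp (y := c *: (y - F 0)).
  by rewrite normrZ gtr0_norm// -(mulfV cN0) ler_wpM2l ?(ltW c0)// distrC ltW.
exists (poly_curve n (v ^~ p) 0 t); last first.
  by apply: (addIr (- F 0)); apply: (scalerI cN0); rewrite -Qpy.
apply: dU; rewrite -ball_normE /= sub0r normrN; apply: le_lt_trans td.
apply: poly_curve_small => // [i|]; first exact: vM.
by rewrite (ltW t0).
Unshelve. all: by end_near.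
Qed.

Local Open Scope quotient_scope.

Section Intrinsic.
Variables (R : realType) (X : normedModType R) (m : nat).
Variables (F : X -> 'rV[R]_m) (D : X -> seq X -> 'rV[R]_m).
Hypothesis DF : derivative_tower F D.

Lemma taylor_coef1 (v : nat -> X) : taylor_coef D 1 v = D 0 [:: v 1%N].
Proof. by rewrite /taylor_coef /= big_seq1. Qed.

Lemma jet_row_init k (v : 'rV[X]_k.+1) i : (i <= k)%N -> jet (row_init v) i = jet v i.
Proof.
case: i => // i ik; have iE : i = Ordinal ik by [].
have iE' : i = widen_ord (leqnSn k) (Ordinal ik) by [].
by rewrite [in LHS]iE jetE mxE [in RHS]iE' jetE.
Qed.

Lemma jet_row_snoc k (v : 'rV[X]_k) i : jet (row_snoc v 0) i = jet v i.
Proof.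
have [ki|] := ltnP k.+1 i; first by rewrite !jet_out// ltnW.
case: i => // i; rewrite ltnS => ik.
pose o : 'I_k.+1 := Ordinal (ik : (i < k.+1)%N).
rewrite -[in LHS](erefl : val o = i) jetE mxE.
case: unliftP => [j|] /(congr1 val) /=; last by move=> ->; rewrite insubF ?ltnn.
by rewrite [bump _ _]lift_max => ->; rewrite valK.
Qed.

(** The domain of an intrinsic differential is cut out by the vanishing of the
    lower differentials on truncated tuples, and a Taylor coefficient of order j
    does not see the vectors of index greater than j. *)
Lemma intrinsic_dom_coef (coim : set X) k (v : 'rV[X]_k.+1) :
  intrinsic_dom F coim v -> forall j, (0 < j <= k.+1)%N -> taylor_coef D j (jet v) = 0.
Proof.
elim: k v => [|k IH] v /=.
  rewrite /ker_diff /= (tower_diff DF) => v0 j j1.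
  have -> : j = 1%N by lia.
  by rewrite taylor_coef1 -[1%N]/((ord0 : 'I_1).+1) jetE.
move=> [domv _ cv0] j /andP[j0]; rewrite leq_eqVlt => /orP[/eqP ->|jk].
  by rewrite -(curve_diff_coef DF).
rewrite -(@taylor_coef_eq _ _ _ D j (jet (row_init v))); first by apply: IH => //; rewrite j0.
by move=> i ij; apply: jet_row_init; apply: leq_trans ij _.
Qed.

Lemma intrinsic_diff_coef k (v : 'rV[X]_k.+1) :
  intrinsic_diff F v = \pi_(coker ('d F (0 : X))) (taylor_coef D k.+2 (jet v)).
Proof.
rewrite /intrinsic_diff (curve_diff_coef DF); congr \pi.
by apply: taylor_coef_eq => i _; apply: jet_row_snoc.
Qed.

Lemma taylor_coef_cvg (T : Type) (G : set_system T) {FG : Filter G} k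
    (v : nat -> T -> X) (a : nat -> X) :
  (forall i, v i x @[x --> G] --> a i) ->
  taylor_coef D k (v ^~ x) @[x --> G] --> taylor_coef D k a.
Proof.
move=> va; apply: sum_cvg => s.
exact: (tower_cvg DF (x := 0) (p := [::])).
Qed.

End Intrinsic.

Lemma jet_cvg (R : realType) (X : normedModType R) (k : nat) (i : nat) :
  continuous (fun v : 'rV[X]_k => jet v i).
Proof.
case: i => [|i] /= v; first exact: cst_continuous.
case: insubP => [j _ _|_] /=; last exact: cst_continuous.
exact: (@matrix_coord_cvg X 1 k ord0 j v).
Qed.

Theorem theorem1p2 (R : realType) (X : completeNormedModType R) (m : nat)
  (F : X -> 'rV[R]_m) (coim : set X) (l n : nat) :
  (2 <= n)%N ->
  smooth F ->
  complement (ker_diff F) coim ->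
  critical_of_corank F l ->
  regular_intrinsic_diff F coim n l ->
  forall U : set X, nbhs (0 : X) U -> nbhs (F 0) (F @` U).
Proof.
case: n => [//|[//|k]] _ [D DF'] _ _ [w [[cw _] domw [g [[_ cg _ gK] _]]]].
have DF : derivative_tower F D := DF'.
have [S cS LS] := linear_section ('d F (0 : X)).
(* [u p] is the jet selected by the class of [p], and [v p] adds the last
   vector, correcting the error [p - A p], which lies in the image. *)
pose u p := w (rootv k.+2 (g (\pi_(coker ('d F (0 : X))) p))).
pose A p := taylor_coef D k.+2 (jet (u p)).
pose v (i : nat) p := if i == k.+2 then S (p - A p) else jet (u p) i.
have cu : continuous u.
  move=> p; pose q : coker ('d F (0 : X)) := \pi p.
  have cq : g (\pi_(coker ('d F (0 : X))) p') @[p' --> p] --> g q.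
    by apply: (@cvg_comp _ _ _ (\pi_(coker ('d F (0 : X)))) g (nbhs p) (nbhs q));
      [exact: pi_continuous|exact: cg].
  have cr : rootv k.+2 (g (\pi_(coker ('d F (0 : X))) p')) @[p' --> p] --> rootv k.+2 (g q).
    by apply: cvg_comp cq _; apply: rootv_continuous.
  by apply: cvg_comp cr _; apply: cw.
have cj i : continuous (fun p => jet (u p) i).
  move=> p; apply: (@cvg_comp _ _ _ u (fun z => jet z i) (nbhs p) (nbhs (u p))).
    exact: cu.
  exact: jet_cvg.
have cA : continuous A.
  move=> p; apply: (@taylor_coef_cvg _ _ _ _ _ DF _ (nbhs p) (nbhs_filter p)) => i.
  exact: cj.
have dS p : D 0 [:: S (p - A p)] = p - A p.
  rewrite -[LHS]/((fun z => D 0 [:: z]) _) -(tower_diff DF); apply: LS.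
  apply/asboolP; apply/coker_pi_eq.
  by rewrite -(intrinsic_diff_coef DF) (gK (\pi p)).
apply: (open_of_approximation DF (n := k.+2) (v := v)) => //.
- move=> i; rewrite /v; case: eqP => _ // p.
  apply: (@cvg_comp _ _ _ (fun p => p - A p) S (nbhs p) (nbhs (p - A p))); last exact: cS.
  by apply: (@cvgB _ _ _ (nbhs p) (nbhs_filter p)); [exact: cvg_id|exact: cA].
- move=> p i ki; rewrite /v gtn_eqF// jet_out// ltnW//.
- move=> p j /andP[j0 jk]; have domu : intrinsic_dom F coim (u p) by apply: domw.
  rewrite -[RHS](intrinsic_dom_coef DF domu (j := j)); last by rewrite j0.
  apply: taylor_coef_eq => i ij; rewrite /v ifF//; apply/negbTE.
  by rewrite neq_ltn (leq_ltn_trans ij).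
- move=> p; have vu i : (i <= k.+1)%N -> v i p = jet (u p) i.
    by move=> ik; rewrite /v ltn_eqF.
  have := taylor_coef_top D vu.
  rewrite {2}/v eqxx dS jet_out// (tower0 DF 0 [::]) subr0 -/(A p).
  by move=> /(canRL (subrK _)) ->; rewrite addrC subrK.
Qed.
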